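(* There is a Borel function $\mathrm{Unit}:\Gamma\to\Gamma$ such that, for every $\gamma\in\Gamma$, $C^*(\mathrm{Unit}(\gamma))$ is isomorphic to the unitization of $C^*(\gamma)$.
   Context: Let $H$ be a separable infinite-dimensional complex Hilbert space, $\mathcal B(H)$ with the Borel structure generated by the weakly open sets, $\Gamma=\mathcal B(H)^{\mathbb N}$ with the product Borel structure, and for $\gamma\in\Gamma$ let $C^*(\gamma)\subseteq\mathcal B(H)$ be the C$^*$-algebra generated by the terms of $\gamma$. The unitization of a C$^*$-algebra $A$ is the C$^*$-algebra obtained by adjoining a new unit, also when $A$ is already unital (so $A$ is a closed ideal of codimension $1$ in it). *)

(* Defs.v *)
From HB Require Import structures.
From mathcomp Require Import all_boot all_order all_algebra.
From mathcomp.real_closed Require Import complex.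
From mathcomp Require Import sesquilinear.
From mathcomp Require Import ring lra.
From mathcomp Require Import boolp classical_sets functions cardinality reals topology.
From mathcomp Require Import normedtype.
From mathcomp Require Import measurable_structure measurable_function.
Set Implicit Arguments.
Unset Strict Implicit.
Unset Printing Implicit Defensive.
Import Order.TTheory GRing.Theory Num.Theory.
Import numFieldNormedType.Exports.
Local Open Scope classical_set_scope.
Local Open Scope ring_scope.
Local Open Scope complex_scope.

(* The library norm of a normed space over [R[i]] takes its values in [R[i]];
   [rnorm] is the same norm with values in [R]. *)
Section RealNorm.
Context {R : realType}.
Implicit Types V : normedModType R[i].

Definition rnorm V (x : V) : R := complex.Re `|x|.

Lemma rnormE V (x : V) : (rnorm x)%:C = `|x|.
Proof. by rewrite /rnorm RRe_real// normr_real. Qed.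

Lemma rnorm_ge0 V (x : V) : 0 <= rnorm x.
Proof. by rewrite -ler0c rnormE normr_ge0. Qed.

Lemma rnorm0 V : rnorm (0 : V) = 0.
Proof. by rewrite /rnorm normr0. Qed.

Lemma rnorm_eq0 V (x : V) : rnorm x = 0 -> x = 0.
Proof. by move=> x0; apply/normr0_eq0; rewrite -rnormE x0. Qed.

Lemma rnormD V (x y : V) : rnorm (x + y) <= rnorm x + rnorm y.
Proof. by rewrite -lecR rmorphD/= !rnormE ler_normD. Qed.

Lemma rnormN V (x : V) : rnorm (- x) = rnorm x.
Proof. by rewrite /rnorm normrN. Qed.

Lemma rnormC V (x y : V) : rnorm (x - y) = rnorm (y - x).
Proof. by rewrite -rnormN opprB. Qed.

Lemma rnormB V (x y z : V) : rnorm (x - z) <= rnorm (x - y) + rnorm (y - z).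
Proof. by apply: le_trans (rnormD _ _); rewrite addrA subrK. Qed.

Lemma rnormZ V (k : R[i]) (x : V) :
  rnorm (k *: x) = rnorm (k : R[i]^o) * rnorm x.
Proof. by apply: complexI; rewrite rmorphM/= !rnormE normrZ. Qed.

Lemma rnormZr V (k : R) (x : V) : 0 <= k -> rnorm (k%:C *: x) = k * rnorm x.
Proof.
move=> k0; rewrite rnormZ; congr (_ * _); apply: complexI; rewrite rnormE.
by rewrite ger0_norm// ler0c.
Qed.

Lemma gt0_complex (e : R[i]) : 0 < e -> exists2 r : R, 0 < r & e = r%:C.
Proof.
move=> e0; exists (complex.Re e); last by rewrite RRe_real// gtr0_real.
by rewrite -(ltcR 0) RRe_real// gtr0_real.
Qed.

Lemma rnorm_cvgP V (F : set_system V) (FF : Filter F) (l : V) :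
  F --> l <-> forall e : R, 0 < e -> \forall x \near F, rnorm (l - x) < e.
Proof.
split=> [/cvgrPdist_lt Fl e e0|Fl].
  have /Fl : 0 < e%:C by rewrite ltcR.
  by apply: filterS => x; rewrite -rnormE ltcR.
apply/cvgrPdist_lt => _ /gt0_complex[r r0 ->].
by apply: filterS (Fl _ r0) => x; rewrite -rnormE ltcR.
Qed.

Lemma rnorm_cauchyP V (F : set_system V) (FF : Filter F) :
  cauchy F <->
  forall e : R, 0 < e -> \forall x & y \near F, rnorm (x - y) < e.
Proof.
split=> [/cauchy_ballP Fc e e0|Fc].
  have /Fc : 0 < e%:C by rewrite ltcR.
  by apply: filterS => -[x y]/=; rewrite -ball_normE/= -rnormE ltcR.
apply/cauchy_ballP => _ /gt0_complex[r r0 ->].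
by apply: filterS (Fc _ r0) => -[x y]/=; rewrite -ball_normE/= -rnormE ltcR.
Qed.

End RealNorm.

Section OperatorNorm.
Context {R : realType}.
Implicit Types V : normedModType R[i].

Definition opnorm V (f : V -> V) : R :=
  sup [set rnorm (f x) | x in [set x | rnorm x <= 1]].

Definition linear_bounded V (f : V -> V) :=
  linear f /\ exists M : R, forall x, rnorm (f x) <= M * rnorm x.

Lemma opnorm_has_sup V (f : V -> V) : linear_bounded f ->
  has_sup [set rnorm (f x) | x in [set x | rnorm x <= 1]].
Proof.
move=> [fl [M fM]]; split; first by exists (rnorm (f 0)), 0; rewrite //= rnorm0.
exists (Num.max M 0) => _ [x /= x1 <-]; apply: le_trans (fM x) _.
rewrite le_max; have [M0|M0] := leP 0 M.
  by rewrite ler_piMr.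
by rewrite mulr_le0_ge0 ?rnorm_ge0 ?orbT// ltW.
Qed.

Lemma opnorm_ge0 V (f : V -> V) : linear_bounded f -> 0 <= opnorm f.
Proof.
move=> fb; apply: le_trans (rnorm_ge0 (f 0)) _.
by apply: sup_upper_bound (opnorm_has_sup fb) _ _; exists 0; rewrite //= rnorm0.
Qed.

Lemma opnorm_le V (f : V -> V) (M : R) : 0 <= M ->
  (forall x, rnorm (f x) <= M * rnorm x) -> opnorm f <= M.
Proof.
move=> M0 fM; apply: ge_sup; first by exists (rnorm (f 0)), 0; rewrite //= rnorm0.
by move=> _ [x /= x1 <-]; apply: le_trans (fM x) _; rewrite ler_piMr.
Qed.

Lemma linear_bounded0 V (f : V -> V) : linear_bounded f -> f 0 = 0.
Proof. by move=> [fl _]; have := fl (-1) 0 0; rewrite scaler0 addr0 scaleN1r addNr. Qed.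

Lemma linear_boundedZ V (f : V -> V) k x : linear_bounded f -> f (k *: x) = k *: f x.
Proof.
move=> fb; have [fl _] := fb; have := fl k x 0.
by rewrite addr0 (linear_bounded0 fb) addr0.
Qed.

Lemma linear_boundedD V (f : V -> V) x y : linear_bounded f -> f (x + y) = f x + f y.
Proof. by move=> [fl _]; rewrite -[x]scale1r fl !scale1r. Qed.

Lemma linear_boundedB V (f : V -> V) x y : linear_bounded f -> f (x - y) = f x - f y.
Proof.
by move=> fb; rewrite linear_boundedD// -scaleN1r linear_boundedZ// scaleN1r.
Qed.

Lemma opnormP V (f : V -> V) x : linear_bounded f ->
  rnorm (f x) <= opnorm f * rnorm x.
Proof.
move=> fb; have [->|x0] := eqVneq x 0.
  by rewrite (linear_bounded0 fb) rnorm0 mulr0.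
have nx0 : 0 < rnorm x.
  by rewrite lt_def rnorm_ge0 andbT; apply: contra x0 => /eqP/rnorm_eq0 ->.
have iV0 : 0 <= (rnorm x)^-1 by rewrite invr_ge0 rnorm_ge0.
rewrite -ler_pdivrMr// mulrC -rnormZr// -(linear_boundedZ _ _ fb).
apply: sup_upper_bound (opnorm_has_sup fb) _ _.
by exists ((rnorm x)^-1%:C *: x); rewrite //= rnormZr// mulVf ?gt_eqF.
Qed.

Lemma linear_bounded_cst V : linear_bounded (fun=> 0 : V).
Proof.
split=> [k x y|]; first by rewrite scaler0 addr0.
by exists 0 => x; rewrite rnorm0 mul0r.
Qed.

Lemma linear_bounded_add V (f g : V -> V) :
  linear_bounded f -> linear_bounded g -> linear_bounded (fun x => f x + g x).
Proof.
move=> [fl [M fM]] [gl [N gN]]; split=> [k x y|].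
  by rewrite fl gl scalerDr addrACA.
exists (M + N) => x; apply: le_trans (rnormD _ _) _.
by rewrite mulrDl lerD.
Qed.

Lemma linear_bounded_scale V (k : R[i]) (f : V -> V) :
  linear_bounded f -> linear_bounded (fun x => k *: f x).
Proof.
move=> [fl [M fM]]; split=> [a x y|].
  by rewrite fl scalerDr !scalerA mulrC.
exists (rnorm (k : R[i]^o) * M) => x.
by rewrite rnormZ -mulrA ler_wpM2l ?rnorm_ge0.
Qed.

Lemma linear_bounded_comp V (f g : V -> V) :
  linear_bounded f -> linear_bounded g -> linear_bounded (f \o g).
Proof.
move=> fb gb; split=> [k x y|].
  by rewrite /= gb.1 fb.1.
exists (opnorm f * opnorm g) => x; apply: le_trans (opnormP _ fb) _.
by rewrite -mulrA ler_wpM2l ?opnorm_ge0// opnormP.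
Qed.

Lemma opnorm_add V (f g : V -> V) : linear_bounded f -> linear_bounded g ->
  opnorm (fun x => f x + g x) <= opnorm f + opnorm g.
Proof.
move=> fb gb; apply: opnorm_le; first by rewrite addr_ge0 ?opnorm_ge0.
by move=> x; apply: le_trans (rnormD _ _) _; rewrite mulrDl lerD ?opnormP.
Qed.

Lemma opnorm_comp V (f g : V -> V) : linear_bounded f -> linear_bounded g ->
  opnorm (f \o g) <= opnorm f * opnorm g.
Proof.
move=> fb gb; apply: opnorm_le; first by rewrite mulr_ge0 ?opnorm_ge0.
move=> x; apply: le_trans (opnormP _ fb) _.
by rewrite -mulrA ler_wpM2l ?opnorm_ge0// opnormP.
Qed.

Lemma opnorm_scale V (k : R[i]) (f : V -> V) : linear_bounded f ->
  opnorm (fun x => k *: f x) = rnorm (k : R[i]^o) * opnorm f.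
Proof.
have le (a : R[i]) g : linear_bounded g ->
    opnorm (fun x : V => a *: g x) <= rnorm (a : R[i]^o) * opnorm g.
  move=> gb; apply: opnorm_le; first by rewrite mulr_ge0 ?opnorm_ge0 ?rnorm_ge0.
  by move=> x; rewrite rnormZ -mulrA ler_wpM2l ?rnorm_ge0 ?opnormP.
move=> fb; apply/eqP; rewrite eq_le le//=.
have [->|k0] := eqVneq k 0.
  by rewrite rnorm0 mul0r opnorm_ge0//; exact: linear_bounded_scale.
have nk0 : 0 < rnorm (k : R[i]^o).
  by rewrite lt_def rnorm_ge0 andbT; apply: contra k0 => /eqP/rnorm_eq0/eqP.
have {1}-> : f = (fun x => k^-1 *: (k *: f x)).
  by apply/funext => x; rewrite scalerA mulVf// scale1r.
rewrite mulrC -ler_pdivlMr// mulrC.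
apply: le_trans (le _ _ _) _; first exact: linear_bounded_scale.
rewrite ler_wpM2r ?opnorm_ge0//; first exact: linear_bounded_scale.
by rewrite -lecR rnormE fmorphV/= rnormE normfV.
Qed.

Lemma opnorm_eq0 V (f : V -> V) x : linear_bounded f -> opnorm f = 0 -> f x = 0.
Proof.
move=> fb f0; apply: rnorm_eq0; apply: le_anti; rewrite rnorm_ge0 andbT.
by apply: le_trans (opnormP _ fb) _; rewrite f0 mul0r.
Qed.

Lemma linear_bounded_continuousP V (f : V -> V) :
  linear_bounded f <-> linear f /\ continuous f.
Proof.
split=> [fb|[fl fc]].
  split; first exact: fb.1.
  move=> x; apply/rnorm_cvgP => e e0.
  have M1 : 0 < opnorm f + 1 by rewrite ltr_wpDl ?opnorm_ge0.
  have /(rnorm_cvgP _ x).1 : nbhs x --> x by [].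
  move=> /(_ (e / (opnorm f + 1))); rewrite divr_gt0// => /(_ isT).
  apply: filterS => y; rewrite ltr_pdivlMr// => xy.
  rewrite /= -(linear_boundedB x y fb).
  apply: le_lt_trans (opnormP _ fb) _.
  apply: le_lt_trans xy; rewrite mulrC ler_wpM2l ?rnorm_ge0//.
  by rewrite lerDl.
have f0 : f 0 = 0.
  by have := fl (-1) 0 0; rewrite scaler0 addr0 scaleN1r addNr.
split=> //; have : f @ (0 : V) --> f 0 := fc 0; rewrite f0 => /rnorm_cvgP/(_ 1 ltr01).
move=> /nbhs_ballP[_ /= /gt0_complex[r r0 ->]] rP.
exists (2 / r) => x; have [->|x0] := eqVneq x 0.
  by rewrite f0 !rnorm0 mulr0.
have nx0 : 0 < rnorm x.
  by rewrite lt_def rnorm_ge0 andbT; apply: contra x0 => /eqP/rnorm_eq0 ->.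
pose k := (r / 2) / rnorm x.
have k0 : 0 < k by rewrite !divr_gt0.
have fZ : f (k%:C *: x) = k%:C *: f x by have := fl k%:C x 0; rewrite !addr0 f0 addr0.
have /rP : ball (0 : V) r%:C (k%:C *: x).
  rewrite -ball_normE/= -rnormE ltcR sub0r rnormN (rnormZr _ (ltW k0)) /k.
  by rewrite divfK ?gt_eqF// ltr_pdivrMr// mulr_natr mulr2n ltrDl.
rewrite /= sub0r rnormN fZ (rnormZr _ (ltW k0)).
rewrite -ltr_pdivlMl// mulr1 => /ltW.
by rewrite /k !invf_div mulrC.
Qed.

End OperatorNorm.

(* C*-algebras, not assumed unital: the library has no non-unital rings, so the
   product is the bilinear operation [cmul]. *)
HB.mixin Record CompleteNormedModule_isCStarAlg (R : realType) A
    of CompleteNormedModule R[i] A := {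
  cmul : A -> A -> A ;
  star : A -> A ;
  cmulA : associative cmul ;
  cmulDl : left_distributive cmul +%R ;
  cmulDr : right_distributive cmul +%R ;
  cmulZl : forall (k : R[i]) x y, cmul (k *: x) y = k *: cmul x y ;
  cmulZr : forall (k : R[i]) x y, cmul x (k *: y) = k *: cmul x y ;
  starK : involutive star ;
  starD : {morph star : x y / x + y} ;
  starZ : forall (k : R[i]) x, star (k *: x) = k^* *: star x ;
  starM : forall x y, star (cmul x y) = cmul (star y) (star x) ;
  cnormM : forall x y : A, `|cmul x y| <= `|x| * `|y| ;
  cnorm_star : forall x : A, `|cmul (star x) x| = `|x| ^+ 2 }.

#[short(type="cstarAlgType")]
HB.structure Definition CStarAlg (R : realType) :=
  {A of CompleteNormedModule R[i] A & CompleteNormedModule_isCStarAlg R A}.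

Local Notation "x ** y" := (cmul x y) (at level 40, left associativity).

(* The isometry of [f] is not required: a bijective *-homomorphism between
   C*-algebras is automatically isometric. *)
Definition cstar_isomorphic (R : realType) (A B : cstarAlgType R) :=
  exists f : A -> B,
    [/\ linear f, bijective f, {morph f : x y / x ** y} & {morph f : x / star x}].

Section CStarNorm.
Context {R : realType} {A : cstarAlgType R}.
Implicit Types x y : A.

Lemma rnormM x y : rnorm (x ** y) <= rnorm x * rnorm y.
Proof. by rewrite -lecR rmorphM/= !rnormE cnormM. Qed.

Lemma rnorm_starM x : rnorm (star x ** x) = rnorm x ^+ 2.
Proof. by apply: complexI; rewrite rmorphXn/= !rnormE cnorm_star. Qed.

Lemma rnorm_star x : rnorm (star x) = rnorm x.
Proof.
have le y : rnorm y <= rnorm (star y).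
  have [y0|y0] := eqVneq (rnorm y) 0; first by rewrite y0 rnorm_ge0.
  have ngt0 : 0 < rnorm y by rewrite lt_def y0 rnorm_ge0.
  by rewrite -(ler_pM2r ngt0) -expr2 -rnorm_starM rnormM.
by apply: le_anti; rewrite le andbT -{2}[x]starK le.
Qed.

Lemma star0 : star (0 : A) = 0.
Proof. by rewrite -[X in star X](scale0r 0) starZ rmorph0 scale0r. Qed.

Lemma starN x : star (- x) = - star x.
Proof. by rewrite -scaleN1r starZ rmorphN1 scaleN1r. Qed.

Lemma cmul0l x : 0 ** x = 0.
Proof. by rewrite -[X in X ** _](scale0r 0) cmulZl scale0r. Qed.

Lemma cmul0r x : x ** 0 = 0.
Proof. by rewrite -[X in _ ** X](scale0r 0) cmulZr scale0r. Qed.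

End CStarNorm.

Section CStarSubalgebra.
Context {R : realType} {A : cstarAlgType R}.

Record is_cstar_subalg (S : set A) : Prop := IsCStarSubalg {
  csubalg0 : S 0 ;
  csubalg_lin : forall (k : R[i]) x y, S x -> S y -> S (k *: x + y) ;
  csubalgM : forall x y, S x -> S y -> S (x ** y) ;
  csubalg_star : forall x, S x -> S (star x) ;
  csubalg_closed : closed S }.

Definition cstar_gen (G : set A) : set A := smallest is_cstar_subalg G.

Lemma cstar_genP (G : set A) : is_cstar_subalg (cstar_gen G).
Proof.
split.
- by move=> S [/csubalg0].
- by move=> k x y Gx Gy S SG; apply: (csubalg_lin SG.1); [apply: Gx|apply: Gy].
- by move=> x y Gx Gy S SG; apply: (csubalgM SG.1); [apply: Gx|apply: Gy].
- by move=> x Gx S SG; apply: (csubalg_star SG.1); apply: Gx.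
- by apply: closed_bigI => S [/csubalg_closed].
Qed.

Record cstar_subalg := CStarSubalg {
  csubalg_set : set A ;
  csubalgP : is_cstar_subalg csubalg_set }.

Definition csubalg_pred (S : cstar_subalg) : {pred A} :=
  fun x => x \in csubalg_set S.

Lemma csubalg_predP (S : cstar_subalg) x :
  x \in csubalg_pred S <-> csubalg_set S x.
Proof. by rewrite -[x \in _]/(x \in csubalg_set S) inE. Qed.

Lemma csubalg_submod (S : cstar_subalg) : GRing.submod_closed (csubalg_pred S).
Proof.
split=> [|k x y]; first by apply/csubalg_predP; exact: csubalg0 (csubalgP S).
move=> /csubalg_predP Sx /csubalg_predP Sy; apply/csubalg_predP.
exact: (csubalg_lin (csubalgP S)).
Qed.

HB.instance Definition _ (S : cstar_subalg) :=
  GRing.isSubmodClosed.Build R[i] A (csubalg_pred S) (csubalg_submod S).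

Record csub (S : cstar_subalg) := CSub {
  csub_val :> A ;
  csub_valP : csub_val \in csubalg_pred S }.

HB.instance Definition _ S := [isSub for @csub_val S].
HB.instance Definition _ S := [Choice of csub S by <:].
HB.instance Definition _ S := [SubChoice_isSubLmodule of csub S by <:].

Section Instance.
Context (S : cstar_subalg).
Implicit Types x y : csub S.

Let cnorm x : R[i] := `|csub_val x|.

Let cnormD x y : cnorm (x + y) <= cnorm x + cnorm y.
Proof. exact: ler_normD. Qed.

Let cnormZ (k : R[i]) x : cnorm (k *: x) = `|k| * cnorm x.
Proof. exact: normrZ. Qed.

Let cnorm0 x : cnorm x = 0 -> x = 0.
Proof. by move=> /normr0_eq0 x0; apply: val_inj; rewrite /= x0. Qed.

HB.instance Definition _ :=
  Lmodule_isNormed.Build R[i] (csub S) cnormD cnormZ cnorm0.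

Lemma csub_rnorm x : rnorm x = rnorm (csub_val x).
Proof. by []. Qed.

Let csub_complete (F : set_system (csub S)) :
  ProperFilter F -> cauchy F -> cvg F.
Proof.
move=> FF /rnorm_cauchyP Fc.
have vc : cauchy (@csub_val S @ F).
  apply/rnorm_cauchyP => e e0; move: (Fc _ e0).
  move=> [[P Q] /= [FP FQ] PQ]; exists (@csub_val S @` P, @csub_val S @` Q).
    by split; [apply: filterS FP|apply: filterS FQ] => x ?; exists x.
  by move=> [_ _] [/= [x Px <-] [y Qy <-]]; exact: (PQ (x, y)).
have /cvg_ex[l vl] : cvg (@csub_val S @ F). by apply: cauchy_cvg.
have Sl : l \in csubalg_pred S.
  apply/csubalg_predP.
  apply: (closed_cvg _ (csubalg_closed (csubalgP S)) _ _ vl).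
  by apply: nearW => x; apply/csubalg_predP; exact: csub_valP.
apply: (cvgP (CSub Sl)); apply/rnorm_cvgP => e e0.
by move/rnorm_cvgP : vl => /(_ _ e0).
Qed.

HB.instance Definition _ := Uniform_isComplete.Build (csub S) csub_complete.

Let memS x : csubalg_set S (csub_val x).
Proof. by apply/csubalg_predP; exact: csub_valP. Qed.

Lemma csub_mul_mem x y : csub_val x ** csub_val y \in csubalg_pred S.
Proof.
by apply/csubalg_predP; apply: (csubalgM (csubalgP S)).
Qed.

Lemma csub_star_mem x : star (csub_val x) \in csubalg_pred S.
Proof.
by apply/csubalg_predP; apply: (csubalg_star (csubalgP S)).
Qed.

Definition csub_mul x y : csub S := CSub (csub_mul_mem x y).
Definition csub_star x : csub S := CSub (csub_star_mem x).

Let mulA : associative csub_mul.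
Proof. by move=> x y z; apply/val_inj/cmulA. Qed.
Let mulDl : left_distributive csub_mul +%R.
Proof. by move=> x y z; apply/val_inj/cmulDl. Qed.
Let mulDr : right_distributive csub_mul +%R.
Proof. by move=> x y z; apply/val_inj/cmulDr. Qed.
Let mulZl (k : R[i]) x y : csub_mul (k *: x) y = k *: csub_mul x y.
Proof. exact/val_inj/cmulZl. Qed.
Let mulZr (k : R[i]) x y : csub_mul x (k *: y) = k *: csub_mul x y.
Proof. exact/val_inj/cmulZr. Qed.
Let stK : involutive csub_star.
Proof. by move=> x; apply/val_inj/starK. Qed.
Let stD : {morph csub_star : x y / x + y}.
Proof. by move=> x y; apply/val_inj/starD. Qed.
Let stZ (k : R[i]) x : csub_star (k *: x) = k^* *: csub_star x.
Proof. exact/val_inj/starZ. Qed.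
Let stM x y : csub_star (csub_mul x y) = csub_mul (csub_star y) (csub_star x).
Proof. exact/val_inj/starM. Qed.
Let normM x y : `|csub_mul x y| <= `|x| * `|y|.
Proof. exact: (@cnormM R A). Qed.
Let norm_star x : `|csub_mul (csub_star x) x| = `|x| ^+ 2.
Proof. exact: (@cnorm_star R A). Qed.

HB.instance Definition _ := CompleteNormedModule_isCStarAlg.Build R (csub S)
  mulA mulDl mulDr mulZl mulZr stK stD stZ stM normM norm_star.

End Instance.
End CStarSubalgebra.

(* The unitization of [A] is [A * C], where [(0, 1)] is the new unit and [A] sits
   as the pairs [(a, 0)].  The C*-norm is the larger of the norm of [(a, l)] acting
   on [A] by left multiplication and of [|l|]; the second term only matters when [A]
   is already unital, as the action is then not faithful. *)
Section Unitization.
Context {R : realType} (A : cstarAlgType R).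

Definition unitization : Type := (A * R[i])%type.

HB.instance Definition _ := GRing.Lmodule.copy unitization (A * R[i]^o)%type.

Implicit Types x y : unitization.

Definition unit_act x (b : A) : A := x.1 ** b + x.2 *: b.

Definition unit_mul x y : unitization :=
  (x.1 ** y.1 + x.2 *: y.1 + y.2 *: x.1, x.2 * y.2).

Definition unit_star x : unitization := (star x.1, x.2^*%R).

Definition unit_norm x : R :=
  Num.max (opnorm (unit_act x)) (rnorm (x.2 : R[i]^o)).

Lemma unit_act_bounded x : linear_bounded (unit_act x).
Proof.
split=> [k b c|].
  rewrite /unit_act cmulDr cmulZr !scalerDr !scalerA addrACA.
  by rewrite [x.2 * k]mulrC.
exists (rnorm x.1 + rnorm (x.2 : R[i]^o)) => b.
by apply: le_trans (rnormD _ _) _; rewrite mulrDl lerD ?rnormM// rnormZ.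
Qed.

Lemma unit_act_mul x y : unit_act (unit_mul x y) = unit_act x \o unit_act y.
Proof.
apply/funext => b; rewrite /unit_act/= !cmulDl !cmulDr !cmulZl !cmulZr cmulA.
by rewrite scalerDr scalerA !addrA; congr (_ + _); rewrite addrAC.
Qed.

Lemma unit_act_add x y : unit_act (x + y) = fun b => unit_act x b + unit_act y b.
Proof. by apply/funext => b; rewrite /unit_act cmulDl scalerDl addrACA. Qed.

Lemma unit_act_scale (k : R[i]) x : unit_act (k *: x) = fun b => k *: unit_act x b.
Proof. by apply/funext => b; rewrite /unit_act scalerDr scalerA cmulZl. Qed.

Let norm x : R[i] := (unit_norm x)%:C.

Lemma unit_norm_ge x :
  opnorm (unit_act x) <= unit_norm x /\ rnorm (x.2 : R[i]^o) <= unit_norm x.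
Proof. by rewrite /unit_norm !le_max !lexx orbT. Qed.

Let normD x y : norm (x + y) <= norm x + norm y.
Proof.
rewrite /norm -rmorphD/= lecR /unit_norm ge_max; apply/andP; split.
  rewrite unit_act_add; apply: le_trans (opnorm_add _ _) _.
  - exact: unit_act_bounded.
  - exact: unit_act_bounded.
  - by apply: lerD; [have [] := unit_norm_ge x|have [] := unit_norm_ge y].
apply: le_trans (rnormD _ _) _.
by apply: lerD; [have [] := unit_norm_ge x|have [] := unit_norm_ge y].
Qed.

Let normZ (k : R[i]) x : norm (k *: x) = `|k| * norm x.
Proof.
rewrite /norm -(rnormE (k : R[i]^o)) -rmorphM/=; congr (_%:C).
have xb := unit_act_bounded x; rewrite /unit_norm unit_act_scale opnorm_scale//.
by rewrite maxr_pMr ?rnorm_ge0//; congr (Num.max _ _); rewrite -rnormZ.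
Qed.

Lemma rnorm_le_act (a : A) : rnorm a <= opnorm (unit_act (a, 0)).
Proof.
have [a0|a0] := eqVneq (rnorm a) 0.
  by rewrite a0; apply/opnorm_ge0/unit_act_bounded.
have ngt0 : 0 < rnorm a by rewrite lt_def a0 rnorm_ge0.
rewrite -(ler_pM2r ngt0) -expr2 -{1}rnorm_star -rnorm_starM starK.
have := opnormP (star a) (unit_act_bounded (a, 0)).
by rewrite /unit_act /= scale0r addr0 rnorm_star.
Qed.

Let norm0 x : norm x = 0 -> x = 0.
Proof.
case: x => a l [] n0.
have l0 : l = 0.
  apply: (@rnorm_eq0 _ R[i]^o); apply: le_anti; rewrite rnorm_ge0 -n0 andbT.
  by have [] := unit_norm_ge (a, l).
subst l; congr pair; apply: rnorm_eq0; apply: le_anti; rewrite rnorm_ge0 andbT.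
apply: le_trans (rnorm_le_act a) _; rewrite -n0.
by have [] := unit_norm_ge (a, 0).
Qed.

HB.instance Definition _ :=
  Lmodule_isNormed.Build R[i] unitization normD normZ norm0.

Lemma unit_rnorm x : rnorm x = unit_norm x.
Proof. by []. Qed.

Lemma rnorm_snd x : rnorm (x.2 : R[i]^o) <= rnorm x.
Proof. by have [] := unit_norm_ge x. Qed.

Lemma opnorm_act x : opnorm (unit_act x) <= rnorm x.
Proof. by have [] := unit_norm_ge x. Qed.

Lemma rnorm_fst x : rnorm x.1 <= 2 * rnorm x.
Proof.
apply: le_trans (rnorm_le_act _) _.
have -> : unit_act (x.1, 0) = fun b => unit_act x b + (- x.2) *: b.
  by apply/funext => b; rewrite /unit_act /= scaleNr scale0r addr0 addrK.
have idb : linear_bounded (fun b : A => b).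
  by split=> //; exists 1 => b; rewrite mul1r.
apply: le_trans (opnorm_add (unit_act_bounded x) (linear_bounded_scale _ idb)) _.
rewrite mulr_natl mulr2n lerD ?opnorm_act// opnorm_scale// rnormN.
apply: le_trans (rnorm_snd x); rewrite ler_piMr ?rnorm_ge0//.
by apply: opnorm_le => // b; rewrite mul1r.
Qed.

Lemma rnorm_pair x : rnorm x <= rnorm x.1 + rnorm (x.2 : R[i]^o).
Proof.
rewrite unit_rnorm /unit_norm ge_max lerDr rnorm_ge0 andbT.
apply: opnorm_le => [|b]; first by rewrite addr_ge0 ?rnorm_ge0.
by apply: le_trans (rnormD _ _) _; rewrite mulrDl lerD ?rnormM// rnormZ.
Qed.

Lemma rnorm_inl (a : A) : rnorm ((a, 0) : unitization) = rnorm a.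
Proof.
apply: le_anti; apply/andP; split.
  by apply: le_trans (rnorm_pair _) _; rewrite /= rnorm0 addr0.
exact: le_trans (rnorm_le_act a) (opnorm_act _).
Qed.

Let Ccomplete (F : set_system R[i]^o) : ProperFilter F -> cauchy F -> cvg F.
Proof.
move=> FF /rnorm_cauchyP Fc.
have part (p : R[i] -> R) : (forall z w, `|p z - p w| <= rnorm (z - w : R[i]^o)) ->
    exists l : R, forall e, 0 < e -> \forall z \near F, `|l - p z| < e.
  move=> plip.
  have pc : cauchy (p @ F).
    apply/cauchy_ballP => e e0; move: (Fc _ e0) => [[P Q] /= [FP FQ] PQ].
    exists (p @` P, p @` Q).
      by split; [apply: filterS FP|apply: filterS FQ] => z ?; exists z.
    move=> [_ _] [/= [z Pz <-] [w Qw <-]]; rewrite -ball_normE/=.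
    exact: le_lt_trans (plip _ _) (PQ (z, w) _).
  have /cvg_ex[l pl] : cvg (p @ F) by apply: cauchy_cvg.
  by exists l => e e0; move/cvgrPdist_lt : pl; exact.
have cE (z : R[i]) : rnorm (z : R[i]^o) = Num.sqrt (complex.Re z ^+ 2 + complex.Im z ^+ 2).
  by rewrite /rnorm normc_def.
have [a la] : exists l : R, forall e, 0 < e -> \forall z \near F, `|l - complex.Re z| < e.
  apply: part => z w; rewrite cE -sqrtr_sqr ler_wsqrtr//.
  by case: z => z1 z2; case: w => w1 w2 /=; rewrite lerDl sqr_ge0.
have [b lb] : exists l : R, forall e, 0 < e -> \forall z \near F, `|l - complex.Im z| < e.
  apply: part => z w; rewrite cE -sqrtr_sqr ler_wsqrtr//.
  by case: z => z1 z2; case: w => w1 w2 /=; rewrite lerDr sqr_ge0.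
apply: (cvgP (a +i* b : R[i]^o)); apply/rnorm_cvgP => e e0.
have e2 : 0 < e / 2 by rewrite divr_gt0.
apply: filterS2 (la _ e2) (lb _ e2) => -[z1 z2] /= h1 h2.
have -> : (a +i* b : R[i]^o) - (z1 +i* z2 : R[i]^o) =
          ((a - z1)%:C : R[i]^o) + (b - z2) *i :> R[i]^o.
  by apply/eqP; rewrite eq_complex /= addr0 add0r !eqxx.
apply: le_lt_trans (rnormD _ _) _; rewrite [ltRHS]splitr !cE/=.
by rewrite expr0n/= addr0 add0r !sqrtr_sqr ltrD.
Qed.

Let complete (F : set_system unitization) : ProperFilter F -> cauchy F -> cvg F.
Proof.
move=> FF /rnorm_cauchyP Fc.
have c1 : cauchy ((fun x => x.1) @ F).
  apply/rnorm_cauchyP => e e0.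
  have e2 : 0 < e / 2 by rewrite divr_gt0.
  move: (Fc _ e2) => [[P Q] /= [FP FQ] PQ].
  exists ((fun x => x.1) @` P, (fun x => x.1) @` Q).
    by split; [apply: filterS FP|apply: filterS FQ] => x ?; exists x.
  move=> [_ _] [/= [x Px <-] [y Qy <-]].
  apply: le_lt_trans (rnorm_fst (x - y)) _.
  by rewrite mulrC -ltr_pdivlMr//; exact: (PQ (x, y)).
have c2 : cauchy ((fun x => x.2 : R[i]^o) @ F).
  apply/rnorm_cauchyP => e e0; move: (Fc _ e0) => [[P Q] /= [FP FQ] PQ].
  exists ((fun x => x.2) @` P, (fun x => x.2) @` Q).
    by split; [apply: filterS FP|apply: filterS FQ] => x ?; exists x.
  move=> [_ _] [/= [x Px <-] [y Qy <-]].
  by apply: le_lt_trans (rnorm_snd (x - y)) _; exact: (PQ (x, y)).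
have /cvg_ex[a /rnorm_cvgP Fa] : cvg ((fun x => x.1) @ F) by apply: cauchy_cvg.
have /cvg_ex[l /rnorm_cvgP Fl] : cvg ((fun x => x.2 : R[i]^o) @ F).
  exact: Ccomplete.
apply: (cvgP ((a, l) : unitization)); apply/rnorm_cvgP => e e0.
have e2 : 0 < e / 2 by rewrite divr_gt0.
have F1 : \forall x \near F, rnorm (a - x.1) < e / 2 := Fa _ e2.
have F2 : \forall x \near F, rnorm (l - x.2 : R[i]^o) < e / 2 := Fl _ e2.
apply: filterS2 F1 F2 => x h1 h2.
by apply: le_lt_trans (rnorm_pair _) _; rewrite [ltRHS]splitr ltrD.
Qed.

HB.instance Definition _ := Uniform_isComplete.Build unitization complete.

Let mulA : associative unit_mul.
Proof.
move=> x y z; congr pair; rewrite /= ?mulrA//.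
rewrite !cmulDl !cmulDr !cmulZl !cmulZr !cmulA !scalerDr !scalerA.
rewrite [z.2 * x.2]mulrC [z.2 * y.2]mulrC.
by rewrite [LHS](AC (3*3*1) ((1*4*2*5)*(3*6*7))).
Qed.
Let mulDl : left_distributive unit_mul +%R.
Proof.
move=> x y z; congr pair; rewrite /= ?mulrDl//.
by rewrite cmulDl scalerDl scalerDr [LHS](AC (2*2*2) ((1*3*5)*(2*4*6))).
Qed.
Let mulDr : right_distributive unit_mul +%R.
Proof.
move=> x y z; congr pair; rewrite /= ?mulrDr//.
by rewrite cmulDr scalerDr scalerDl [LHS](AC (2*2*2) ((1*3*5)*(2*4*6))).
Qed.
Let mulZl (k : R[i]) x y : unit_mul (k *: x) y = k *: unit_mul x y.
Proof.
congr pair; rewrite /= -?mulrA//.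
by rewrite cmulZl !scalerDr !scalerA [y.2 * k]mulrC.
Qed.
Let mulZr (k : R[i]) x y : unit_mul x (k *: y) = k *: unit_mul x y.
Proof.
congr pair; rewrite /= 1?[LHS]mulrCA//.
by rewrite cmulZr !scalerDr !scalerA [x.2 * k]mulrC.
Qed.
Let stK : involutive unit_star.
Proof. by move=> [a l]; rewrite /unit_star /= starK conjCK. Qed.
Let stD : {morph unit_star : x y / x + y}.
Proof. by move=> x y; congr pair; rewrite /= ?starD// rmorphD. Qed.
Let stZ (k : R[i]) x : unit_star (k *: x) = k^* *: unit_star x.
Proof. by congr pair; rewrite /= ?starZ// rmorphM. Qed.
Let stM x y : unit_star (unit_mul x y) = unit_mul (unit_star y) (unit_star x).
Proof.
congr pair; rewrite /=; last by rewrite rmorphM mulrC.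
by rewrite !starD !starZ starM addrAC.
Qed.

Let rnorm_unitM x y : rnorm (unit_mul x y) <= rnorm x * rnorm y.
Proof.
rewrite unit_rnorm /unit_norm ge_max; apply/andP; split.
  rewrite unit_act_mul; apply: le_trans (opnorm_comp _ _) _.
  - exact: unit_act_bounded.
  - exact: unit_act_bounded.
  - by rewrite ler_pM ?opnorm_act// opnorm_ge0//; exact: unit_act_bounded.
rewrite /= -[X in rnorm X]/(x.2 *: (y.2 : R[i]^o)) rnormZ.
by rewrite ler_pM ?rnorm_ge0 ?rnorm_snd.
Qed.

Let act_star x (b : A) :
  star (unit_act x b) ** unit_act x b = star b ** unit_act (unit_mul (unit_star x) x) b.
Proof.
rewrite unit_act_mul/=; set w := unit_act x b; rewrite {1}/w /unit_act /=; move: w => w.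
by rewrite starD starM starZ cmulDl cmulDr cmulA cmulZl cmulZr.
Qed.

Let opnorm_act_sqr x :
  opnorm (unit_act x) ^+ 2 <= opnorm (unit_act (unit_mul (unit_star x) x)).
Proof.
set p := opnorm (unit_act (unit_mul _ _)).
have p0 : 0 <= p by apply/opnorm_ge0/unit_act_bounded.
rewrite -[leRHS]sqr_sqrtr// lerXn2r ?nnegrE ?sqrtr_ge0//.
  by apply/opnorm_ge0/unit_act_bounded.
apply: opnorm_le => [|b]; first exact: sqrtr_ge0.
rewrite -(@ler_pXn2r _ 2) ?nnegrE ?mulr_ge0 ?sqrtr_ge0 ?rnorm_ge0//.
rewrite exprMn sqr_sqrtr// -rnorm_starM act_star.
apply: le_trans (rnormM _ _) _; rewrite rnorm_star.
rewrite expr2 mulrCA ler_wpM2l ?rnorm_ge0//.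
exact/opnormP/unit_act_bounded.
Qed.

Let opnorm_act_starM x :
  opnorm (unit_act (unit_mul (unit_star x) x)) = opnorm (unit_act x) ^+ 2.
Proof.
have act0 y : 0 <= opnorm (unit_act y) by apply/opnorm_ge0/unit_act_bounded.
have leM y : opnorm (unit_act (unit_mul (unit_star y) y)) <=
    opnorm (unit_act (unit_star y)) * opnorm (unit_act y).
  by rewrite unit_act_mul; apply: opnorm_comp; exact: unit_act_bounded.
have le y : opnorm (unit_act y) <= opnorm (unit_act (unit_star y)).
  have [y0|y0] := eqVneq (opnorm (unit_act y)) 0; first by rewrite y0.
  have ygt0 : 0 < opnorm (unit_act y) by rewrite lt_def y0 act0.
  rewrite -(ler_pM2r ygt0) -expr2.
  exact: le_trans (opnorm_act_sqr y) (leM y).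
apply: le_anti; rewrite opnorm_act_sqr andbT.
apply: le_trans (leM x) _; rewrite expr2 ler_wpM2r//.
by rewrite -{2}[x]stK le.
Qed.

Let normM x y : `|unit_mul x y| <= `|x| * `|y|.
Proof. by rewrite -!rnormE -rmorphM/= lecR rnorm_unitM. Qed.

Let norm_star x : `|unit_mul (unit_star x) x| = `|x| ^+ 2.
Proof.
have act0 : 0 <= opnorm (unit_act x) by apply/opnorm_ge0/unit_act_bounded.
rewrite -!rnormE -rmorphXn/=; congr (_%:C).
rewrite !unit_rnorm /unit_norm opnorm_act_starM.
have -> : rnorm ((unit_mul (unit_star x) x).2 : R[i]^o) = rnorm (x.2 : R[i]^o) ^+ 2.
  apply: complexI; rewrite rmorphXn/= !rnormE.
  by rewrite normrM norm_conjC.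
have x0 := rnorm_ge0 (x.2 : R[i]^o).
move: (opnorm _) (rnorm _) act0 x0 => o r o0 r0.
have [le|/ltW le] := leP o r; first by rewrite max_r// lerXn2r.
by rewrite max_l// lerXn2r.
Qed.

HB.instance Definition _ := CompleteNormedModule_isCStarAlg.Build R unitization
  mulA mulDl mulDr mulZl mulZr stK stD stZ stM normM norm_star.

End Unitization.

HB.mixin Record CompleteNormedModule_isHilbert (R : realType) H
    of CompleteNormedModule R[i] H := {
  hdot : {dot H for (@Num.conj R[i])} ;
  hdotxx : forall x : H, hdot x x = `|x| ^+ 2 }.

#[short(type="hilbertType")]
HB.structure Definition Hilbert (R : realType) :=
  {H of CompleteNormedModule R[i] H & CompleteNormedModule_isHilbert R H}.

Definition separable_space (T : topologicalType) := exists2 D : set T, countable D & dense D.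

Definition infinite_dimensional (K : fieldType) (V : lmodType K) :=
  forall (n : nat) (e : 'I_n -> V),
    ~ forall x : V, exists c : 'I_n -> K, x = \sum_(i < n) c i *: e i.

Section Riesz.
Context {R : realType} {H : hilbertType R}.
Implicit Types x y z : H.

Local Notation cabs z := (rnorm (z : R[i]^o)).

Lemma hdotC x y : hdot x y = (hdot y x)^*%R.
Proof. by rewrite hermC mul1r. Qed.

Lemma hdotDl x y z : hdot (x + y) z = hdot x z + hdot y z.
Proof. exact: linearDl. Qed.

Lemma hdotDr x y z : hdot x (y + z) = hdot x y + hdot x z.
Proof. by rewrite hdotC hdotDl rmorphD/= -!hdotC. Qed.

Lemma hdotZl (k : R[i]) x y : hdot (k *: x) y = k * hdot x y.
Proof. exact: linearZl_LR. Qed.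

Lemma hdotZr (k : R[i]) x y : hdot x (k *: y) = k^*%R * hdot x y.
Proof. by rewrite hdotC hdotZl rmorphM/= -hdotC. Qed.

Lemma hdot0l x : hdot 0 x = 0.
Proof. by rewrite -(scale0r 0) hdotZl mul0r. Qed.

Lemma hdotNl x y : hdot (- x) y = - hdot x y.
Proof. by rewrite -scaleN1r hdotZl mulN1r. Qed.

Lemma hdotBl x y z : hdot (x - y) z = hdot x z - hdot y z.
Proof. by rewrite hdotDl hdotNl. Qed.

Lemma hdotBr x y z : hdot x (y - z) = hdot x y - hdot x z.
Proof. by rewrite hdotC hdotBl rmorphB/= -!hdotC. Qed.

Lemma hdot_rnorm x : hdot x x = (rnorm x ^+ 2)%:C.
Proof. by rewrite hdotxx rmorphXn/= rnormE. Qed.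

Lemma rnormD2 x y :
  rnorm (x + y) ^+ 2 = rnorm x ^+ 2 + 2 * complex.Re (hdot y x) + rnorm y ^+ 2.
Proof.
apply: complexI; rewrite -hdot_rnorm !hdotDl !hdotDr !hdot_rnorm [hdot x y]hdotC.
apply/eqP; rewrite eq_complex /=; case: (hdot y x) => a b.
by apply/andP; split; apply/eqP => /=; ring.
Qed.

Lemma quad_bound (c n : R) (g : R[i]) : 0 < n ->
  (forall t : R[i], 0 <= c + 2 * complex.Re (t * g) + cabs t ^+ 2 * n ^+ 2) ->
  cabs g ^+ 2 <= c * n ^+ 2.
Proof.
move=> n0 /(_ (- (n ^- 2)%:C * g^*%R)).
have -> : - (n ^- 2)%:C * g^*%R * g = (- (n ^- 2 * cabs g ^+ 2))%:C.
  rewrite -mulrA [_^* * _]mulrC -normCK -(rnormE (g : R[i]^o)).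
  by rewrite rmorphN rmorphM/= [in RHS]rmorphXn/= mulNr.
have -> : cabs (- (n ^- 2)%:C * g^*%R) = n ^- 2 * cabs g.
  apply: complexI; rewrite rmorphM/= !rnormE normrM normrN norm_conjC.
  by congr (_ * _); rewrite ger0_norm// ler0c invr_ge0 exprn_ge0// ltW.
move=> /= h; rewrite -ler_pdivrMr ?exprn_gt0//.
rewrite -subr_ge0; apply: le_trans h _; rewrite le_eqVlt; apply/orP; left.
by apply/eqP; field; rewrite gt_eqF.
Qed.

Lemma cauchy_schwarz x y : cabs (hdot x y) <= rnorm x * rnorm y.
Proof.
have [->|x0] := eqVneq x 0; first by rewrite hdot0l !rnorm0 mul0r.
have nx0 : 0 < rnorm x.
  by rewrite lt_def rnorm_ge0 andbT; apply: contra x0 => /eqP/rnorm_eq0 ->.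
rewrite -(@ler_pXn2r _ 2) ?nnegrE ?mulr_ge0 ?rnorm_ge0// exprMn mulrC.
apply: quad_bound => // t; rewrite -exprMn -rnormZ -hdotZl -rnormD2.
exact: sqr_ge0.
Qed.

Lemma riesz_representation (f : H -> R[i]) (M : R) : scalar f ->
  (forall x, cabs (f x) <= M * rnorm x) -> exists z, forall x, f x = hdot x z.
Proof.
move=> fl fM.
have f0 : f 0 = 0 by have := fl (-1) 0 0; rewrite scaler0 addr0 mulN1r addNr.
have fZ k x : f (k *: x) = k * f x by have := fl k x 0; rewrite addr0 f0 addr0.
have fD x y : f (x + y) = f x + f y by have := fl 1 x y; rewrite scale1r mul1r.
pose J x := rnorm x ^+ 2 - 2 * complex.Re (f x).
pose m := inf (range J).
have Jinf : has_inf (range J).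
  split; first by exists (J 0), 0.
  exists (- M ^+ 2) => _ [x _ <-]; rewrite /J.
  have Re_f : complex.Re (f x) <= M * rnorm x.
    apply: le_trans (fM x); rewrite -lecR rnormE.
    by apply: le_trans (normc_ge_Re _); rewrite lecR ler_norm.
  have := sqr_ge0 (rnorm x - M); nra.
have mJ x : m <= J x by apply: (ge_inf Jinf.2); exists x.
pose E (e : R) := [set x | J x < m + e ^+ 2].
have Ene e : 0 < e -> exists x, E e x.
  move=> e0; have /(inf_adherent (exprn_gt0 2 e0))[_ [x _ <-] xe] := Jinf.
  by exists x.
have key e x y : 0 < e -> E e x -> cabs (hdot y x - f y) <= e * rnorm y.
  move=> e0 Ex; have [->|y0] := eqVneq y 0.
    by rewrite hdot0l f0 subrr !rnorm0 mulr0.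
  have ny0 : 0 < rnorm y.
    by rewrite lt_def rnorm_ge0 andbT; apply: contra y0 => /eqP/rnorm_eq0 ->.
  rewrite -(@ler_pXn2r _ 2) ?nnegrE ?mulr_ge0 ?rnorm_ge0 ?(ltW e0)// exprMn.
  apply: quad_bound => // t.
  have := mJ (x + t *: y); rewrite /J rnormD2 rnormZ exprMn fD fZ hdotZl.
  move: Ex; rewrite /E/= /J mulrBr !raddfD/= raddfN/=.
  set u := complex.Re _; set v := complex.Re (t * f y); set w := complex.Re _.
  lra.
pose F := filter_from [set e : R | 0 < e] E.
have Ffilter : Filter F.
  apply: filter_from_filter; first by exists 1 => /=.
  move=> e d /= e0 d0; exists (Num.min e d); first by rewrite lt_min e0.
  have k0 : 0 <= Num.min e d by rewrite le_min !ltW.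
  have mono (a : R) x : 0 < a -> Num.min e d <= a -> E (Num.min e d) x -> E a x.
    move=> a0 ka /lt_le_trans; apply.
    by rewrite lerD2l lerXn2r// nnegrE ltW.
  by move=> x Ex; split; apply: mono Ex => //; rewrite ge_min lexx ?orbT.
have FF : ProperFilter F by exact: (filter_from_proper Ffilter Ene).
have Fc : cauchy F.
  apply/rnorm_cauchyP => e e0; have e4 : 0 < e / 4 by rewrite divr_gt0.
  exists (E (e / 4), E (e / 4)); first by split; exists (e / 4).
  move=> [x y] [/= Ex Ey].
  have h : rnorm (x - y) * rnorm (x - y) <= (e / 2) * rnorm (x - y).
    have -> : rnorm (x - y) * rnorm (x - y) = cabs (hdot (x - y) (x - y)).
      apply: complexI.
      by rewrite hdot_rnorm rnormE ger0_norm ?ler0c ?sqr_ge0// expr2.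
    have -> : hdot (x - y) (x - y) =
        (hdot (x - y) x - f (x - y)) - (hdot (x - y) y - f (x - y)).
      by rewrite hdotBr opprB addrA subrK.
    apply: le_trans (rnormD _ _) _; rewrite rnormN.
    by apply: le_trans (lerD (key _ _ _ e4 Ex) (key _ _ _ e4 Ey)) _; lra.
  have [->|xy0] := eqVneq (rnorm (x - y)) 0; first by [].
  have : 0 < rnorm (x - y) by rewrite lt_def xy0 rnorm_ge0.
  by move=> xy; move: h; rewrite ler_pM2r//; lra.
have /cvg_ex[z /rnorm_cvgP Fz] : cvg F by apply: cauchy_cvg.
exists z => y; apply/eqP; rewrite eq_sym -subr_eq0; apply/eqP.
apply: (@rnorm_eq0 _ R[i]^o); apply: le_anti; rewrite rnorm_ge0 andbT.
apply/ler_addgt0Pr => e e0; rewrite add0r.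
have Y : 0 < rnorm y + 1 by rewrite ltr_wpDl ?rnorm_ge0.
pose d := e / 2 / (rnorm y + 1).
have d0 : 0 < d by rewrite !divr_gt0.
have /filter_ex[x [/ltW xz Ex]] : F ([set x | rnorm (z - x) < d] `&` E d).
  by apply: filterI; [exact: Fz|exists d].
have -> : hdot y z - f y = hdot y (z - x) + (hdot y x - f y).
  by rewrite hdotBr addrA subrK.
apply: le_trans (rnormD _ _) _.
apply: le_trans (lerD (cauchy_schwarz _ _) (key _ _ _ d0 Ex)) _.
have dE : d * (rnorm y + 1) = e / 2 by rewrite /d divfK ?gt_eqF.
have := rnorm_ge0 y; have := rnorm_ge0 (z - x); nra.
Qed.

End Riesz.

(* [bop H] is B(H). *)
Section BoundedOperators.
Context {R : realType} (H : hilbertType R).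

Definition bop_pred : {pred H -> H} :=
  fun f => f \in [set f : H -> H | linear f /\ continuous f].

Lemma bop_predP f : f \in bop_pred <-> linear_bounded f.
Proof.
rewrite -[f \in _]/(f \in [set f : H -> H | linear f /\ continuous f]) inE.
by split=> [/linear_bounded_continuousP|/linear_bounded_continuousP].
Qed.

Lemma bop_submod : GRing.submod_closed bop_pred.
Proof.
split=> [|k f g]; first by apply/bop_predP; exact: linear_bounded_cst.
move=> /bop_predP fb /bop_predP gb; apply/bop_predP.
exact: linear_bounded_add (linear_bounded_scale k fb) gb.
Qed.

HB.instance Definition _ :=
  GRing.isSubmodClosed.Build R[i] (H -> H) bop_pred bop_submod.

Record bop := Bop { bop_fun :> H -> H ; bop_funP : bop_fun \in bop_pred }.

HB.instance Definition _ := [isSub for bop_fun].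
HB.instance Definition _ := [Choice of bop by <:].
HB.instance Definition _ := [SubChoice_isSubLmodule of bop by <:].

Implicit Types S T : bop.

Lemma bopP T : linear_bounded T.
Proof. by apply/bop_predP; exact: bop_funP. Qed.

Lemma bop_ext S T : (forall x, S x = T x) -> S = T.
Proof. by move=> ST; apply/val_inj/funext. Qed.

Let norm T : R[i] := (opnorm T)%:C.

Let normD S T : norm (S + T) <= norm S + norm T.
Proof. by rewrite /norm -rmorphD/= lecR; apply: opnorm_add; exact: bopP. Qed.

Let normZ (k : R[i]) T : norm (k *: T) = `|k| * norm T.
Proof.
rewrite /norm -(rnormE (k : R[i]^o)) -rmorphM/=; congr (_%:C).
exact/opnorm_scale/bopP.
Qed.

Let norm0 T : norm T = 0 -> T = 0.
Proof. by move=> [T0]; apply: bop_ext => x; exact: (opnorm_eq0 _ (bopP T)). Qed.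

HB.instance Definition _ := Lmodule_isNormed.Build R[i] bop normD normZ norm0.

Lemma bop_rnorm T : rnorm T = opnorm T.
Proof. by []. Qed.

Lemma bop_rnormP T x : rnorm (T x) <= rnorm T * rnorm x.
Proof. exact/opnormP/bopP. Qed.

Lemma bop_rnorm_le T (M : R) :
  0 <= M -> (forall x, rnorm (T x) <= M * rnorm x) -> rnorm T <= M.
Proof. exact: opnorm_le. Qed.

Let complete (F : set_system bop) : ProperFilter F -> cauchy F -> cvg F.
Proof.
move=> FF /rnorm_cauchyP Fc.
have lx (x : H) : exists l : H, forall e : R, 0 < e -> 
    \forall T \near F, rnorm (l - (T : bop) x) < e.
  have xc : cauchy ((fun T : bop => T x) @ F).
    apply/rnorm_cauchyP => e e0.
    have Y : 0 < rnorm x + 1 by rewrite ltr_wpDl ?rnorm_ge0.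
    have d0 : 0 < e / (rnorm x + 1) by rewrite divr_gt0.
    move: (Fc _ d0) => [[P Q] /= [FP FQ] PQ].
    exists ((fun T : bop => T x) @` P, (fun T : bop => T x) @` Q).
      by split; [apply: filterS FP|apply: filterS FQ] => T ?; exists T.
    move=> [_ _] [/= [S PS <-] [T QT <-]].
    apply: le_lt_trans (bop_rnormP (S - T) x) _.
    have := PQ (S, T) (conj PS QT); rewrite /= ltr_pdivlMr//.
    by have := rnorm_ge0 (S - T); have := rnorm_ge0 x; nra.
  have /cvg_ex[l /rnorm_cvgP Fl] : cvg ((fun T : bop => T x) @ F).
    by apply: cauchy_cvg.
  by exists l.
have [L LP] := choice lx.
have LT (e : R) : 0 < e ->
    \forall T \near F, forall x, rnorm (L x - (T : bop) x) <= e * rnorm x.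
  move=> e0; move: (Fc _ e0) => [[P Q] /= [FP FQ] PQ].
  apply: filterS FP => T PT x; apply/ler_addgt0Pr => d d0.
  have /filter_ex[S [QS Sx]] : F (Q `&` [set S : bop | rnorm (L x - S x) < d]).
    by apply: filterI => //; exact: LP.
  apply: le_trans (rnormB _ (S x) _) _; rewrite addrC; apply: lerD; last exact: ltW.
  rewrite rnormC; apply: le_trans (bop_rnormP (T - S) x) _.
  by rewrite ler_wpM2r ?rnorm_ge0//; exact/ltW/(PQ (T, S)).
have Lb : linear_bounded L.
  have [T TL] := filter_ex (LT _ ltr01); split.
    move=> k x y; apply/eqP; rewrite -subr_eq0; apply/eqP.
    apply: rnorm_eq0; apply: le_anti; rewrite rnorm_ge0 andbT.
    apply/ler_addgt0Pr => e e0; rewrite add0r.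
    pose M := rnorm (k *: x + y) + rnorm (k : R[i]^o) * rnorm x + rnorm y.
    have M0 : 0 <= M by rewrite !addr_ge0 ?mulr_ge0 ?rnorm_ge0.
    have M1 : 0 < M + 1 by rewrite ltr_wpDl.
    have d0 : 0 < e / (M + 1) by rewrite divr_gt0.
    have [S SL] := filter_ex (LT _ d0).
    have -> : L (k *: x + y) - (k *: L x + L y) =
        (L (k *: x + y) - S (k *: x + y)) + (k *: (S x - L x) + (S y - L y)).
      by rewrite (bopP S).1 scalerBr [X in _ = _ + X]addrACA -opprD addrA subrK.
    apply: le_trans (rnormD _ _) _.
    apply: le_trans (lerD (SL _) (rnormD _ _)) _; rewrite rnormZ.
    rewrite [rnorm (S x - _)]rnormC [rnorm (S y - _)]rnormC.
    have k0 := rnorm_ge0 (k : R[i]^o).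
    have h := ler_wpM2l k0 (SL x).
    apply: le_trans (lerD (lexx _) (lerD h (SL y))) _.
    rewrite mulrCA -!mulrDr addrA -/M.
    by rewrite mulrAC ler_pdivrMr// ler_pM2l// lerDl.
  exists (1 + rnorm T) => x; rewrite mulrDl -[L x](subrK (T x)).
  by apply: le_trans (rnormD _ _) _; rewrite lerD ?TL// bop_rnormP.
apply: (cvgP (Bop ((bop_predP L).2 Lb))); apply/rnorm_cvgP => e e0.
have e2 : 0 < e / 2 by rewrite divr_gt0.
apply: filterS (LT _ e2) => T TL.
have : rnorm (Bop ((bop_predP L).2 Lb) - T) <= e / 2.
  by apply: bop_rnorm_le => //; exact: ltW.
by move/le_lt_trans; apply; rewrite ltr_pdivrMr// mulr_natr mulr2n ltrDl.
Qed.

HB.instance Definition _ := Uniform_isComplete.Build bop complete.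

Definition bop_mul S T : bop :=
  Bop ((bop_predP _).2 (linear_bounded_comp (bopP S) (bopP T))).

Lemma bop_adjoint_exists T (y : H) : exists z : H, forall x : H, hdot (T x) y = hdot x z.
Proof.
apply: (@riesz_representation _ _ _ (rnorm T * rnorm y)) => [k u v|x].
  by rewrite (bopP T).1 hdotDl hdotZl.
apply: le_trans (cauchy_schwarz _ _) _; rewrite mulrAC.
by rewrite ler_wpM2r ?rnorm_ge0 ?bop_rnormP.
Qed.

Definition adjoint_fun T (y : H) : H := sval (cid (bop_adjoint_exists T y)).

Lemma adjoint_funP T (x y : H) : hdot (T x) y = hdot x (adjoint_fun T y).
Proof. by rewrite /adjoint_fun; case: cid. Qed.

Lemma hdot_inj (y z : H) : (forall x : H, hdot x y = hdot x z :> R[i]) -> y = z.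
Proof.
move=> yz; apply/eqP; rewrite -subr_eq0 -(dnorm_eq0 (@hdot R H)).
by rewrite hdotBr yz subrr.
Qed.

Let adjoint_linear T : linear (adjoint_fun T).
Proof.
move=> k y z; apply: hdot_inj => x.
by rewrite -adjoint_funP !hdotDr !hdotZr -!adjoint_funP.
Qed.

Let adjoint_le T y : rnorm (adjoint_fun T y) <= rnorm T * rnorm y.
Proof.
have [->|y0] := eqVneq (rnorm (adjoint_fun T y)) 0.
  by rewrite mulr_ge0 ?rnorm_ge0.
have ngt0 : 0 < rnorm (adjoint_fun T y) by rewrite lt_def y0 rnorm_ge0.
rewrite -(ler_pM2r ngt0) -expr2.
have -> : rnorm (adjoint_fun T y) ^+ 2 =
    rnorm (hdot (T (adjoint_fun T y)) y : R[i]^o).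
  by apply: complexI; rewrite adjoint_funP hdot_rnorm rnormE ger0_norm// ler0c sqr_ge0.
apply: le_trans (cauchy_schwarz _ _) _; rewrite mulrAC.
by rewrite ler_wpM2r ?rnorm_ge0 ?bop_rnormP.
Qed.

Lemma adjoint_bounded T : linear_bounded (adjoint_fun T).
Proof. by split; [exact: adjoint_linear|exists (rnorm T); exact: adjoint_le]. Qed.

Definition adjoint T : bop := Bop ((bop_predP _).2 (adjoint_bounded T)).

Lemma adjointP T x y : hdot (T x) y = hdot x (adjoint T y).
Proof. exact: adjoint_funP. Qed.

Let mulA : associative bop_mul.
Proof. by move=> S T U; apply: bop_ext. Qed.
Let mulDl : left_distributive bop_mul +%R.
Proof. by move=> S T U; apply: bop_ext. Qed.
Let mulDr : right_distributive bop_mul +%R.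
Proof. by move=> S T U; apply: bop_ext => x; exact: linear_boundedD (bopP S). Qed.
Let mulZl (k : R[i]) S T : bop_mul (k *: S) T = k *: bop_mul S T.
Proof. by apply: bop_ext. Qed.
Let mulZr (k : R[i]) S T : bop_mul S (k *: T) = k *: bop_mul S T.
Proof. by apply: bop_ext => x; exact: linear_boundedZ (bopP S). Qed.
Let stK : involutive adjoint.
Proof.
move=> T; apply: bop_ext => y; apply: hdot_inj => x.
by rewrite -adjointP hdotC -adjointP -hdotC.
Qed.
Let stD : {morph adjoint : S T / S + T}.
Proof.
move=> S T; apply: bop_ext => y; apply: hdot_inj => x.
by rewrite -adjointP hdotDl hdotDr -!adjointP.
Qed.
Let stZ (k : R[i]) T : adjoint (k *: T) = k^* *: adjoint T.
Proof.
apply: bop_ext => y; apply: hdot_inj => x.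
by rewrite -adjointP hdotZl hdotZr conjCK -adjointP.
Qed.
Let stM S T : adjoint (bop_mul S T) = bop_mul (adjoint T) (adjoint S).
Proof. by apply: bop_ext => y; apply: hdot_inj => x; rewrite -adjointP -!adjointP. Qed.
Let rnorm_mul S T : rnorm (bop_mul S T) <= rnorm S * rnorm T.
Proof. exact: opnorm_comp (bopP S) (bopP T). Qed.
Let normM S T : `|bop_mul S T| <= `|S| * `|T|.
Proof. by rewrite -!rnormE -rmorphM/= lecR. Qed.
Let rnorm_adjoint T : rnorm (adjoint T) <= rnorm T.
Proof. by apply: bop_rnorm_le; [exact: rnorm_ge0|exact: adjoint_le]. Qed.
Let norm_star T : `|bop_mul (adjoint T) T| = `|T| ^+ 2.
Proof.
rewrite -!rnormE -rmorphXn/=; congr (_%:C); apply: le_anti; apply/andP; split.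
  apply: le_trans (rnorm_mul _ _) _.
  by rewrite expr2 ler_wpM2r ?rnorm_ge0.
set p := rnorm (bop_mul _ _); have p0 : 0 <= p by exact: rnorm_ge0.
rewrite -[leRHS]sqr_sqrtr// lerXn2r ?nnegrE ?sqrtr_ge0 ?rnorm_ge0//.
apply: bop_rnorm_le => [|x]; first exact: sqrtr_ge0.
rewrite -(@ler_pXn2r _ 2) ?nnegrE ?mulr_ge0 ?sqrtr_ge0 ?rnorm_ge0//.
rewrite exprMn sqr_sqrtr//.
have -> : rnorm (T x) ^+ 2 = rnorm (hdot x (bop_mul (adjoint T) T x) : R[i]^o).
  apply: complexI.
  by rewrite -adjointP hdot_rnorm rnormE ger0_norm// ler0c sqr_ge0.
apply: le_trans (cauchy_schwarz _ _) _; rewrite expr2 mulrCA.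
by rewrite ler_wpM2l ?rnorm_ge0 ?bop_rnormP.
Qed.

HB.instance Definition _ := CompleteNormedModule_isCStarAlg.Build R bop
  mulA mulDl mulDr mulZl mulZr stK stD stZ stM normM norm_star.

End BoundedOperators.

Section Gamma.
Context {R : realType} (H : hilbertType R).

(* "Weakly" refers to the weak operator topology. *)
Definition weakly_open (U : set (bop H)) :=
  forall T, U T -> exists (s : seq (H * H)) (e : R), 0 < e /\
    forall S : bop H,
      (forall p, p \in s -> `|hdot (S p.1) p.2 - hdot (T p.1) p.2| < e%:C) -> U S.

Definition gamma_cylinders : set (set (nat -> bop H)) :=
  [set C | exists n (U : set (bop H)), <<s weakly_open >> U /\ C = [set g | U (g n)]].

Definition Gamma := g_sigma_algebraType gamma_cylinders.

Definition Cstar (g : Gamma) : cstarAlgType R :=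
  csub (CStarSubalg (cstar_genP (range (g : nat -> bop H)))).

End Gamma.

(* Main.v *)
Require Import Defs.
From mathcomp Require Import all_boot all_order all_algebra.
From mathcomp.real_closed Require Import complex.
From mathcomp Require Import sesquilinear ring lra.
From mathcomp Require Import boolp classical_sets reals topology normedtype sequences.
From mathcomp Require Import measurable_structure measurable_function.
Set Implicit Arguments.
Unset Strict Implicit.
Unset Printing Implicit Defensive.
Import Order.TTheory GRing.Theory Num.Theory.
Import numFieldNormedType.Exports.
Local Open Scope classical_set_scope.
Local Open Scope ring_scope.
Local Open Scope complex_scope.

(* Let [V] be an isometry of [H] whose range is orthogonal to a unit vector [e0].
   Then [(a, l) |-> V a V* + l] is a faithful representation of the unitization of
   any algebra of operators on [H]: compressing by [V] recovers [a + l], and the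
   vector state at [e0] recovers [l], because [V* e0 = 0].  Its image is generated
   by the identity and the operators [V (g n) V*], and [T |-> V T V*] is weakly
   continuous, hence Borel.

   [V] shifts an orthonormal sequence and fixes its orthogonal complement.  It is the
   strong limit of [W n x = rotate n (x - <x, e n> e n)], where the unitary [rotate n]
   is a product of reflections that cycles [e 0, ..., e n]. *)

Local Notation "x ** y" := (cmul x y) (at level 40, left associativity).
Local Notation cabs z := (rnorm (z : _[i]^o)).

(** * Finite orthonormal families and the construction of an orthonormal sequence *)

Section Orthonormal.
Context {R : realType} {H : hilbertType R}.

Definition orthonormal_family (I : eqType) (e : I -> H) :=
  forall i j, hdot (e i) (e j) = (i == j)%:R :> R[i].

Lemma hdot_suml I (s : seq I) (a : I -> H) (y : H) :
  hdot (\sum_(i <- s) a i) y = \sum_(i <- s) hdot (a i) y :> R[i].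
Proof.
elim: s => [|i s IH]; first by rewrite !big_nil hdot0l.
by rewrite !big_cons hdotDl IH.
Qed.

Lemma hdot_orthonormal_sum (I : eqType) (e : I -> H) (s : seq I) (a : I -> R[i]) j :
  orthonormal_family e -> uniq s -> j \in s ->
  hdot (\sum_(i <- s) a i *: e i) (e j) = a j.
Proof.
move=> oe us js; rewrite hdot_suml (bigD1_seq j)//= hdotZl oe eqxx mulr1.
by rewrite big1 ?addr0// => i ij; rewrite hdotZl oe (negbTE ij) mulr0.
Qed.

Lemma hdot_sumr I (s : seq I) (a : I -> H) (x : H) :
  hdot x (\sum_(i <- s) a i) = \sum_(i <- s) hdot x (a i) :> R[i].
Proof.
rewrite hdotC hdot_suml rmorph_sum; apply: eq_bigr => i _.
exact/esym/hdotC.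
Qed.

Lemma rnorm_orthonormal_sum (I : eqType) (e : I -> H) (s : seq I) (a : I -> R[i]) :
  orthonormal_family e -> uniq s ->
  rnorm (\sum_(i <- s) a i *: e i) ^+ 2 = \sum_(i <- s) cabs (a i) ^+ 2.
Proof.
move=> oe us; apply: complexI; rewrite -hdot_rnorm hdot_sumr rmorph_sum/=.
set p := (X in hdot X); rewrite big_seq [RHS]big_seq; apply: eq_bigr => j js.
by rewrite hdotZr {}/p hdot_orthonormal_sum// rmorphXn/= rnormE normCKC.
Qed.

(** Pythagoras: the projection [p] of [x] onto the span is orthogonal to [x - p], and the sum is the
    squared norm of [p]. *)
Lemma bessel (I : eqType) (e : I -> H) (s : seq I) (x : H) :
  orthonormal_family e -> uniq s ->
  \sum_(i <- s) cabs (hdot x (e i)) ^+ 2 <= rnorm x ^+ 2.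
Proof.
move=> oe us; rewrite -(rnorm_orthonormal_sum (fun i => hdot x (e i)) oe us).
set p := \sum_(i <- s) _; suff -> : rnorm x ^+ 2 = rnorm p ^+ 2 + rnorm (x - p) ^+ 2.
  by rewrite lerDl sqr_ge0.
have := rnormD2 (x - p) p; rewrite subrK => ->.
suff -> : hdot p (x - p) = 0 :> R[i] by rewrite /= mulr0 addr0 addrC.
rewrite {1}/p hdot_suml big_seq big1// => i is_; rewrite hdotZl [hdot (e i) _]hdotC hdotBl.
by rewrite hdot_orthonormal_sum// subrr conjC0 mulr0.
Qed.

(** Some [x] lies outside the finite span; its residual after projection is nonzero and orthogonal
    to the family, and is then normalised. *)
Lemma orthonormal_extend n (e : 'I_n -> H) :
  infinite_dimensional H -> orthonormal_family e ->
  exists u : H, hdot u u = 1 :> R[i] /\ forall i, hdot u (e i) = 0 :> R[i].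
Proof.
move=> Hinf oe; have /existsNP[x xe] := Hinf n e.
pose p := \sum_(i < n) hdot x (e i) *: e i.
have px : rnorm (x - p) != 0.
  apply/eqP => /rnorm_eq0/eqP; rewrite subr_eq0 => /eqP xp.
  by apply: xe; exists (fun i => hdot x (e i)).
exists ((rnorm (x - p))^-1%:C *: (x - p)); split=> [|i].
  rewrite hdotZl hdotZr hdot_rnorm (_ : Num.conj _ = (rnorm (x - p))^-1%:C);
    last exact: conjc_real.
  by rewrite -!rmorphM/= expr2 mulKf// mulVf.
by rewrite hdotZl hdotBl hdot_orthonormal_sum ?mem_index_enum ?index_enum_uniq// subrr mulr0.
Qed.

Lemma orthonormal_sequence :
  infinite_dimensional H -> exists e : nat -> H, orthonormal_family e.
Proof.
move=> Hinf.
(* Orthonormality is a premise inside [nextP], so that a next vector can be chosen for every list;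
   for the other lists any vector serves. *)
pose nextP (s : seq H) (u : H) := orthonormal_family (fun i : 'I_(size s) => s`_i) ->
  hdot u u = 1 :> R[i] /\ forall i : 'I_(size s), hdot u s`_i = 0 :> R[i].
have ex s : exists u, nextP s u.
  have [os|nos] := pselect (orthonormal_family (fun i : 'I_(size s) => s`_i)).
    by have [u] := orthonormal_extend Hinf os; exists u.
  by exists 0 => /nos.
have [next nexts] := choice ex.
have [L L0 LS] : exists2 L, L 0 = [::] & forall n, L n.+1 = rcons (L n) (next (L n)).
  by exists (fun n => iter n (fun s => rcons s (next s)) [::]).
have sL n : size (L n) = n by elim: n => [|n IH]; rewrite ?L0// LS size_rcons IH.
have [e eE] : exists e, forall n, e n = next (L n) by exists (next \o L).
have Le n i : (i < n)%N -> (L n)`_i = e i.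
  elim: n => // n IH; rewrite ltnS leq_eqVlt LS nth_rcons sL => /orP[/eqP->|ii].
    by rewrite ltnn eqxx eE.
  by rewrite ii IH.
(* Any two indices are covered by a common list [L n], so orthonormality of each finite list is
   enough. *)
suff oL n : orthonormal_family (fun i : 'I_(size (L n)) => (L n)`_i).
  exists e => i j; have [n [iN jN]] : exists n, (i < n)%N /\ (j < n)%N.
    by exists (maxn i j).+1; rewrite !ltnS leq_maxl leq_maxr.
  have := jN; have := iN; rewrite -{1 2}(sL n) => iL jL.
  by have := oL n (Ordinal iL) (Ordinal jL); rewrite /= !Le.
elim: n => [|n IH]; first by rewrite L0 => -[].
have [e1 eo] := nexts _ IH; rewrite -eE in e1 eo.
have eo' j : (j < n)%N -> hdot (e n) (e j) = 0 :> R[i].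
  move=> jn; have jN : (j < size (L n))%N by rewrite sL.
  by have := eo (Ordinal jN); rewrite /= Le.
have ee j k : (j < n)%N -> (k < n)%N -> hdot (e j) (e k) = (j == k)%:R :> R[i].
  move=> jn kn; have := jn; have := kn; rewrite -{1 2}(sL n) => kN jN.
  by have := IH (Ordinal jN) (Ordinal kN); rewrite /= !Le.
move=> [i iL] [j jL]; rewrite -[_ == _]/(i == j).
have iN : (i < n.+1)%N by rewrite -(sL n.+1).
have jN : (j < n.+1)%N by rewrite -(sL n.+1).
transitivity (hdot (e i) (e j) : R[i]); first by rewrite -(Le _ _ iN) -(Le _ _ jN).
move: iN jN; rewrite !ltnS (leq_eqVlt i) (leq_eqVlt j) => /orP[/eqP->|iN] /orP[/eqP->|jN].
- by rewrite eqxx.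
- by rewrite eo'// gtn_eqF.
- by rewrite hdotC eo'// conjC0 ltn_eqF.
- exact: ee.
Qed.

End Orthonormal.

(** * The shift isometry as a strong limit *)

Section Shift.
Context {R : realType} {H : hilbertType R}.

Lemma hdot_cvg T (F : set_system T) {FF : Filter F} (u v : T -> H) (x y : H) :
  u @ F --> x -> v @ F --> y -> (fun t => hdot (u t) (v t) : R[i]^o) @ F --> (hdot x y : R[i]^o).
Proof.
move=> /rnorm_cvgP ux /rnorm_cvgP vy; apply/rnorm_cvgP => e e0.
have a0 := rnorm_ge0 x; have b0 := rnorm_ge0 y.
set M := rnorm x + rnorm y + 1; have M0 : 0 < M by rewrite ltr_wpDl ?addr_ge0.
(* The bound 1 makes the cross term at most [d], which the summand 1 of [M] absorbs; the total error
   is then at most [d * M], hence at most [e / 2]. *)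
set d := Num.min 1 (e / 2 / M).
have d0 : 0 < d by rewrite lt_min ltr01 !divr_gt0.
have [d1 dM] : d <= 1 /\ d * M <= e / 2.
  by split; [rewrite ge_min lexx|rewrite -ler_pdivlMr// ge_min lexx orbT].
have Fu : \forall t \near F, rnorm (x - u t) < d := ux _ d0.
have Fv : \forall t \near F, rnorm (y - v t) < d := vy _ d0.
apply: filterS2 Fu Fv => t ut vt /=.
have -> : hdot x y - hdot (u t) (v t) =
    hdot (x - u t) y + (hdot x (y - v t) - hdot (x - u t) (y - v t)) :> R[i]^o.
  by rewrite -hdotBl subKr hdotBl hdotBr addrA subrK.
apply: le_lt_trans (rnormD _ _) _.
apply: le_lt_trans (lerD (cauchy_schwarz _ _) (rnormD _ _)) _; rewrite rnormN.
apply: le_lt_trans (lerD (lexx _) (lerD (cauchy_schwarz _ _) (cauchy_schwarz _ _))) _.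
have := rnorm_ge0 (x - u t); have := rnorm_ge0 (y - v t).
move: (rnorm _) (rnorm (x - u t)) ut vt => q p pd qd q0 p0.
have h1 := ler_wpM2r b0 (ltW pd); have h2 := ler_wpM2l a0 (ltW qd).
have h3 : p * q <= d * 1 by rewrite ler_pM// ltW// (lt_le_trans qd).
by move: dM; rewrite /M; lra.
Qed.

(** Transfers inner product identities from the approximants [W n] to their strong limit. *)
Lemma hdot_lim_eq (u v u' v' : nat -> H) (x y x' y' : H) :
  u @ \oo --> x -> v @ \oo --> y -> u' @ \oo --> x' -> v' @ \oo --> y' ->
  (forall n, hdot (u n) (v n) = hdot (u' n) (v' n) :> R[i]) -> hdot x y = hdot x' y' :> R[i].
Proof.
move=> ux vy ux' vy' eq.
have h : (fun n => hdot (u n) (v n) : R[i]^o) @ \oo --> (hdot x y : R[i]^o).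
  exact: hdot_cvg.
have h' : (fun n => hdot (u n) (v n) : R[i]^o) @ \oo --> (hdot x' y' : R[i]^o).
  by under eq_fun do rewrite eq; exact: hdot_cvg.
exact: (cvg_unique (@norm_hausdorff _ R[i]^o) h h').
Qed.

(** The squared norm of a block of the series is the same block of the scalar series of squares,
    which is Cauchy because its partial sums increase and are bounded. *)
Lemma orthonormal_series_cvg (e : nat -> H) (a : nat -> R[i]) (B : R) :
  orthonormal_family e -> (forall n, \sum_(0 <= i < n) cabs (a i) ^+ 2 <= B) ->
  cvgn (series (fun i => a i *: e i)).
Proof.
move=> oe aB; apply: cauchy_cvg; apply/cauchy_seriesP => _ /gt0_complex[r r0 ->].
have : cvgn (series (fun i => cabs (a i) ^+ 2)).
  apply: nondecreasing_is_cvgn.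
    by apply: nondecreasing_series => i _ _; exact: sqr_ge0.
  by exists B => _ [n _ <-]; exact: aB.
move=> /cvg_cauchy/cauchy_seriesP/(_ (r ^+ 2)); rewrite exprn_gt0// => /(_ isT).
apply: filterS => -[m n] /=; rewrite -rnormE ltcR.
rewrite -(rnorm_orthonormal_sum _ oe) ?iota_uniq// ger0_norm ?sqr_ge0//.
by rewrite ltr_pXn2r// nnegrE ?rnorm_ge0// ltW.
Qed.

Section ShiftLimit.
Context {e : nat -> H} (oe : orthonormal_family e).

(** These are the terms of a convergent series. Hence removing the [e n] component of [x] does not
    affect limits. *)
Lemma orthonormal_coord_cvg0 (x : H) : hdot x (e n) *: e n @[n --> \oo] --> 0.
Proof.
apply: cvg_series_cvg_0; apply: (@orthonormal_series_cvg _ _ (rnorm x ^+ 2)) => // n.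
by apply: bessel; rewrite ?iota_uniq.
Qed.

(* The reflection exchanging [e n] and [e n.+1], since their difference has squared
   norm 2. *)
Definition swap n (x : H) : H := x - hdot x (e n - e n.+1) *: (e n - e n.+1).

Lemma hdot_diff n : hdot (e n - e n.+1) (e n - e n.+1) = 2 :> R[i].
Proof. by rewrite hdotBl !hdotBr !oe !eqxx ltn_eqF// gtn_eqF//=; ring. Qed.

Lemma hdot_swap n x y : hdot (swap n x) (swap n y) = hdot x y :> R[i].
Proof.
rewrite /swap hdotBl !hdotBr !hdotZl !hdotZr hdot_diff.
rewrite [hdot (e n - e n.+1) y]hdotC; ring.
Qed.

Lemma swap_succ n : swap n (e n.+1) = e n.
Proof. by rewrite /swap hdotBr !oe eqxx gtn_eqF// sub0r scaleN1r opprK addrC subrK. Qed.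

Lemma swap_id n k : (n.+1 < k)%N -> swap n (e k) = e k.
Proof.
move=> nk; rewrite /swap hdotBr !oe !gtn_eqF//; last exact: ltn_trans nk.
by rewrite subrr scale0r subr0.
Qed.

(** The swap of highest index acts first: [e n] descends step by step to [e 0], while each [e k]
    with [k < n] moves to [e k.+1]. *)
Fixpoint rotate n x := if n is n'.+1 then rotate n' (swap n' x) else x.

Lemma hdot_rotate n x y : hdot (rotate n x) (rotate n y) = hdot x y :> R[i].
Proof. by elim: n x y => //= n IH x y; rewrite IH hdot_swap. Qed.

Lemma rotate_last n : rotate n (e n) = e 0.
Proof. by elim: n => //= n IH; rewrite swap_succ. Qed.

Lemma rotate_id n k : (n < k)%N -> rotate n (e k) = e k.
Proof.
elim: n => //= n IH nk; rewrite swap_id// IH//; exact: ltn_trans nk.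
Qed.

Lemma rotate_linear n : linear (rotate n).
Proof.
elim: n => //= n IH k x y; rewrite -IH; congr rotate.
by rewrite /swap hdotDl hdotZl scalerDl opprD addrACA -scalerA -scalerBr.
Qed.

(** Separates the image of the [e n] component from partial sums of a series that does not depend on
    [n]; each summand replaces the coordinate along [e i.+1] by the one along [e i]. *)
Lemma rotateE n x : rotate n x = hdot x (e n) *: e 0 + (x - hdot x (e 0) *: e 0 +
   \sum_(0 <= i < n) hdot x (e i - e i.+1) *: e i.+1).
Proof.
elim: n => [|n IH]; first by rewrite big_geq//= addr0 addrC subrK.
rewrite big_nat_recr//= {1}/swap -scaleNr (addrC x) rotate_linear IH.
have -> : rotate n (e n - e n.+1) = e 0 - e n.+1.
  rewrite -[in LHS]scaleN1r addrC rotate_linear rotate_id// rotate_last.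
  by rewrite scaleN1r addrC.
have -> : hdot x (e n) = hdot x (e n - e n.+1) + hdot x (e n.+1) :> R[i].
  by rewrite hdotBr subrK.
rewrite scaleNr scalerBr opprB scalerDl -!addrA addKr.
by rewrite addrC -!addrA.
Qed.
End ShiftLimit.

Lemma shift_isometry : infinite_dimensional H ->
  exists (V : bop H) (e0 : H), [/\ hdot e0 e0 = 1 :> R[i],
    forall x y, hdot (V x) (V y) = hdot x y :> R[i] &
    forall x, hdot (V x) e0 = 0 :> R[i]].
Proof.
move=> /orthonormal_sequence[e oe].
pose W n x := x - hdot x (e 0) *: e 0 + \sum_(0 <= i < n) hdot x (e i - e i.+1) *: e i.+1.
(* Since [rotate n] sends [e n] to [e 0], removing the [e n] component cancels the leading term of
   [rotateE]. *)
have WE n x : W n x = rotate (e := e) n (x - hdot x (e n) *: e n).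
  rewrite -scaleNr (addrC x) rotate_linear rotate_last// rotateE// scaleNr.
  by rewrite addrA addNr add0r.
have Wcvg x : cvgn (W ^~ x).
  apply: is_cvgD; first exact: is_cvg_cst.
  apply: (@orthonormal_series_cvg (e \o S) _ (4 * rnorm x ^+ 2)) => [i j|n].
    by rewrite /= oe.
  (* The square of a sum is at most twice the sum of the squares, and Bessel applies to both [e] and
     the shifted family [e \o S]. *)
  have -> : 4 * rnorm x ^+ 2 = 2 * (rnorm x ^+ 2 + rnorm x ^+ 2) by lra.
  have b1 := bessel x oe (iota_uniq 0 (n - 0)).
  have oeS : orthonormal_family (e \o S) by move=> i j; rewrite /= oe.
  have b2 := bessel x oeS (iota_uniq 0 (n - 0)).
  apply: (@le_trans _ _ (2 * (\sum_(0 <= i < n) cabs (hdot x (e i)) ^+ 2 +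
                              \sum_(0 <= i < n) cabs (hdot x (e i.+1)) ^+ 2))).
    rewrite -big_split mulr_sumr; apply: ler_sum => i _ /=.
    have le : cabs (hdot x (e i - e i.+1)) <= cabs (hdot x (e i)) + cabs (hdot x (e i.+1)).
      by rewrite hdotBr; apply: le_trans (rnormD _ _) _; rewrite rnormN.
    have h := lerXn2r 2 (rnorm_ge0 _) (le_trans (rnorm_ge0 _) le) le.
    apply: le_trans h _.
    have := sqr_ge0 (cabs (hdot x (e i)) - cabs (hdot x (e i.+1))).
    by rewrite sqrrB sqrrD; lra.
  by rewrite ler_pM2l// lerD.
pose V x := limn (W ^~ x).
have VP x : W ^~ x @ \oo --> V x by exact: Wcvg.
have Vdot x y : hdot (V x) (V y) = hdot x y :> R[i].
  (* [W n] is a unitary applied to a vector tending to [z], so inner products are preserved in the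
     limit. *)
  have tcvg z : (fun n => z - hdot z (e n) *: e n) @ \oo --> z.
    rewrite -[z in X in _ --> X]subr0; apply: cvgB; first exact: cvg_cst.
    exact: orthonormal_coord_cvg0.
  by apply: (hdot_lim_eq (VP x) (VP y) (tcvg x) (tcvg y)) => n; rewrite !WE hdot_rotate.
have Vlin : linear V.
  move=> k x y; apply: (cvg_unique (@norm_hausdorff _ _) (VP _)).
  have -> : W ^~ (k *: x + y) = (fun n => k *: W n x + W n y).
    apply/funext => n; rewrite !WE -rotate_linear; congr rotate.
    by rewrite hdotDl hdotZl scalerDl opprD addrACA -scalerA -scalerBr.
  by apply: cvgD; [exact: cvgZl_tmp|].
have Vb : linear_bounded V.
  split=> //; exists 1 => x; rewrite mul1r -(@ler_pXn2r _ 2) ?nnegrE ?rnorm_ge0//.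
  by rewrite -lecR -!hdot_rnorm Vdot.
exists (Bop ((bop_predP _).2 Vb)), (e 0); split=> [|//|x]; first by rewrite oe eqxx.
rewrite -(hdot0l (e 0)).
apply: (hdot_lim_eq (VP x) (cvg_cst _) (cvg_cst _) (cvg_cst _)) => n.
(* Writing [e 0] as [rotate n (e n)] reduces the claim to the orthogonality of [e n] and a vector
   whose [e n] component was removed. *)
rewrite WE -[in LHS](rotate_last oe n) hdot_rotate// hdot0l.
by rewrite hdotBl hdotZl oe eqxx mulr1 subrr.
Qed.

End Shift.

(** * The faithful representation of the unitization on [H] *)

Section Ampliation.
Context {R : realType} {H : hilbertType R}.

Lemma linear_bounded_id (V : normedModType R[i]) : linear_bounded (@id V).
Proof. by split=> //; exists 1 => x; rewrite mul1r. Qed.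

Definition bop_id : bop H := Bop ((bop_predP _).2 (linear_bounded_id H)).

Lemma bop_mul1 (T : bop H) : bop_id ** T = T.
Proof. exact: bop_ext. Qed.

Lemma bop_mulr1 (T : bop H) : T ** bop_id = T.
Proof. exact: bop_ext. Qed.

Lemma star_bop_id : star bop_id = bop_id.
Proof.
rewrite -[LHS]bop_mulr1 -[in RHS](starK bop_id) -[in RHS](bop_mulr1 (star bop_id)).
by rewrite starM starK.
Qed.

Lemma linear_bounded_sandwich (S T : bop H) : linear_bounded (fun X : bop H => S ** X ** T).
Proof.
split=> [k X Y|]; first by rewrite cmulDr cmulDl cmulZr cmulZl.
exists (rnorm S * rnorm T) => X; apply: le_trans (rnormM _ _) _.
by rewrite mulrAC ler_wpM2r ?rnorm_ge0// rnormM.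
Qed.

Lemma linear_bounded_vector_state (x : H) (T : bop H) :
  linear_bounded (fun X : bop H => (hdot (X x) x : R[i]) *: T).
Proof.
split=> [k X Y|]; first by rewrite hdotDl hdotZl scalerDl scalerA.
exists (rnorm x * rnorm x * rnorm T) => X; rewrite rnormZ mulrAC ler_wpM2r ?rnorm_ge0//.
apply: le_trans (cauchy_schwarz _ _) _.
by rewrite mulrAC ler_wpM2r ?rnorm_ge0// mulrC bop_rnormP.
Qed.

Section Isometry.
Context (V : bop H) (e0 : H) (e01 : hdot e0 e0 = 1 :> R[i])
  (Vdot : forall x y, hdot (V x) (V y) = hdot x y :> R[i])
  (Ve0 : forall x, hdot (V x) e0 = 0 :> R[i]).

Lemma isometry_starM : star V ** V = bop_id.
Proof. by apply: bop_ext => y; apply: hdot_inj => x; rewrite -[RHS]Vdot adjointP. Qed.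

Lemma star_isometry_orthogonal : star V e0 = 0.
Proof. by apply: hdot_inj => x; rewrite -[LHS]adjointP Ve0 hdotC hdot0l conjC0. Qed.

Definition ampliate (a : bop H) (l : R[i]) : bop H := V ** a ** star V + l *: bop_id.

Definition scalar_part (T : bop H) : R[i] := hdot (T e0) e0.

Definition compression (T : bop H) : bop H :=
  star V ** T ** V - scalar_part T *: bop_id.

Lemma scalar_part_ampliate a l : scalar_part (ampliate a l) = l.
Proof.
have -> : scalar_part (ampliate a l) = hdot (V (a (star V e0)) + l *: e0) e0 by [].
by rewrite hdotDl Ve0 add0r hdotZl e01 mulr1.
Qed.

Lemma compression_ampliate a l : compression (ampliate a l) = a.
Proof.
rewrite /compression scalar_part_ampliate /ampliate cmulDr cmulDl cmulZr cmulZl bop_mulr1.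
rewrite isometry_starM addrK !cmulA isometry_starM bop_mul1.
by rewrite -cmulA isometry_starM bop_mulr1.
Qed.

Lemma ampliate_linear k a b l m :
  ampliate (k *: a + b) (k * l + m) = k *: ampliate a l + ampliate b m.
Proof.
rewrite /ampliate cmulDr cmulDl cmulZr cmulZl scalerDl -scalerA.
by rewrite scalerDr addrACA.
Qed.

(** The arguments on the left are the components of the product in the unitization;
    [star V ** V = bop_id] merges the two conjugated factors. *)
Lemma ampliateM a b l m :
  ampliate (a ** b + l *: b + m *: a) (l * m) = ampliate a l ** ampliate b m.
Proof.
rewrite /ampliate !cmulDr !cmulDl !cmulZr !cmulZl !bop_mulr1 !bop_mul1.
have -> : V ** a ** star V ** (V ** b ** star V) = V ** (a ** b) ** star V.
  rewrite !cmulA -(cmulA (V ** a)) isometry_starM bop_mulr1.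
  by rewrite -!cmulA.
by rewrite scalerA mulrC -!addrA.
Qed.

Lemma ampliate_star a l : ampliate (star a) l^*%R = star (ampliate a l).
Proof. by rewrite /ampliate starD starZ star_bop_id !starM starK cmulA. Qed.

Lemma linear_bounded_compression : linear_bounded compression.
Proof.
apply: linear_bounded_add; first exact: linear_bounded_sandwich.
have -> : (fun T => - (scalar_part T *: bop_id)) = (fun T => -1 *: (scalar_part T *: bop_id)).
  by apply/funext => T; rewrite scaleN1r.
exact/linear_bounded_scale/linear_bounded_vector_state.
Qed.

(** Vanishes exactly when [T] has the form [ampliate a l], as [compression T] and [scalar_part T]
    are the only candidates for [a] and [l]. *)
Definition ampliate_defect (T : bop H) : bop H :=
  ampliate (compression T) (scalar_part T) - T.

Lemma linear_bounded_ampliate_defect : linear_bounded ampliate_defect.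
Proof.
apply: linear_bounded_add; first apply: linear_bounded_add.
- exact: (linear_bounded_comp (linear_bounded_sandwich V (star V)) linear_bounded_compression).
- exact: linear_bounded_vector_state.
have -> : -%R = (fun T : bop H => -1 *: T) by apply/funext => T; rewrite scaleN1r.
exact/linear_bounded_scale/linear_bounded_id.
Qed.

Definition ampliation (A : set (bop H)) : set (bop H) :=
  [set T | exists a l, A a /\ T = ampliate a l].

(* Gives closedness of the image, as both maps are continuous. *)
Lemma ampliationE A :
  ampliation A = compression @^-1` A `&` ampliate_defect @^-1` [set 0].
Proof.
apply/seteqP; split=> [_ [a [l [Aa ->]]]|T [AT /= /eqP]].
  by rewrite /ampliate_defect /= /ampliate_defect compression_ampliate scalar_part_ampliate subrr.
by rewrite subr_eq0 => /eqP TE; exists (compression T), (scalar_part T).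
Qed.

Lemma ampliation_csubalg A : is_cstar_subalg A -> is_cstar_subalg (ampliation A).
Proof.
move=> AP; split.
- exists 0, 0; split; first exact: csubalg0 AP.
  by rewrite /ampliate cmul0r cmul0l scale0r addr0.
- move=> k _ _ [a [l [Aa ->]]] [b [m [Ab ->]]].
  exists (k *: a + b), (k * l + m); rewrite ampliate_linear; split=> //.
  exact: (csubalg_lin AP).
- move=> _ _ [a [l [Aa ->]]] [b [m [Ab ->]]].
  exists (a ** b + l *: b + m *: a), (l * m); rewrite ampliateM; split=> //.
  rewrite addrC; apply: (csubalg_lin AP) => //; rewrite addrC.
  by apply: (csubalg_lin AP) => //; exact: (csubalgM AP).
- move=> _ [a [l [Aa ->]]]; exists (star a), l^*%R; rewrite ampliate_star.
  by split=> //; exact: (csubalg_star AP).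
- rewrite ampliationE; apply: closedI; apply: closed_comp.
  + by move=> T _; apply: ((linear_bounded_continuousP _).1 linear_bounded_compression).2.
  + exact: (csubalg_closed AP).
  + by move=> T _; apply: ((linear_bounded_continuousP _).1 linear_bounded_ampliate_defect).2.
  + exact/accessible_closed_set1/hausdorff_accessible/norm_hausdorff.
Qed.

End Isometry.
End Ampliation.

(** * The map on sequences: Borel measurability and the generated algebra *)

Lemma cstar_isomorphic_sym (R : realType) (A B : cstarAlgType R) :
  cstar_isomorphic A B -> cstar_isomorphic B A.
Proof.
move=> [f [flin [g fK gK] fM fstar]]; exists g; split.
- by move=> k x y; apply: (can_inj fK); rewrite flin !gK.
- by exists f.
- by move=> x y; apply: (can_inj fK); rewrite fM !gK.
- by move=> x; apply: (can_inj fK); rewrite fstar !gK.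
Qed.

(** The sets with measurable preimage form a sigma-algebra, so it suffices to test generators. *)
Lemma g_sigma_preimage_sub T T' (G : set (set T)) (G' : set (set T')) (f : T' -> T) :
  (forall U, G U -> <<s G' >> (f @^-1` U)) ->
  forall U, <<s G >> U -> <<s G' >> (f @^-1` U).
Proof.
move=> Gf; apply: (@smallest_sub _ _ G [set U | <<s G' >> (f @^-1` U)]) => //.
have -> : [set U | <<s G' >> (f @^-1` U)] = image_set_system setT f <<s G' >>.
  by apply/funext => U; rewrite /image_set_system /= setTI.
exact/sigma_algebra_image/smallest_sigma_algebra.
Qed.

Section UnitizationOperator.
Context {R : realType} {H : hilbertType R}.

(** The identity at index 0 supplies the scalars and shifts the conjugated terms by one index. *)
Definition ampliate_seq (V : bop H) (g : Gamma H) : Gamma H :=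
  fun n => if n is n'.+1 then V ** g n' ** star V else @bop_id R H.

(** The matrix coefficient of [V ** T ** star V] at a pair of vectors is that of [T] at their images
    under [star V]. *)
Lemma weakly_open_sandwich (V : bop H) (U : set (bop H)) : weakly_open U ->
  weakly_open ((fun T : bop H => V ** T ** star V) @^-1` U).
Proof.
move=> Uo T /Uo[s [e [e0 sU]]].
exists [seq (star V p.1, star V p.2) | p <- s], e; split=> // S ST.
apply: sU => p ps; have := ST _ (map_f _ ps).
have E (X : bop H) : hdot ((V ** X ** star V) p.1) p.2 =
    hdot (X (star V p.1)) (star V p.2) :> R[i] by exact: (adjointP V (X (star V p.1))).
by rewrite !E.
Qed.

Lemma measurable_ampliate_seq (V : bop H) : measurable_fun setT (ampliate_seq V).
Proof.
apply: (@measurability _ _ (Gamma H) (Gamma H) setT (ampliate_seq V)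
  (@gamma_cylinders R H)) => // _ [_ [n [U [mU ->]]] <-].
rewrite setTI; case: n => [|n].
  (* The coordinate 0 is constant, so the preimage is everything or empty. *)
  have [U1|U1] := pselect (U (@bop_id R H)).
    by rewrite (_ : _ @^-1` _ = setT)//; apply/seteqP; split.
  by rewrite (_ : _ @^-1` _ = set0)//; apply/seteqP; split.
apply: sub_sigma_algebra; exists n, ((fun T : bop H => V ** T ** star V) @^-1` U); split=> //.
apply: g_sigma_preimage_sub mU => W Wo; apply: sub_sigma_algebra.
exact: weakly_open_sandwich.
Qed.

Context (V : bop H) (e0 : H) (e01 : hdot e0 e0 = 1 :> R[i])
  (Vdot : forall x y, hdot (V x) (V y) = hdot x y :> R[i])
  (Ve0 : forall x, hdot (V x) e0 = 0 :> R[i]).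

Lemma cstar_gen_ampliate_seq (g : Gamma H) :
  cstar_gen (range (ampliate_seq V g : nat -> bop H)) =
  ampliation V (cstar_gen (range (g : nat -> bop H))).
Proof.
set B := cstar_gen (range (ampliate_seq V g : nat -> bop H)).
have BP : is_cstar_subalg B := cstar_genP _.
have rangeB n : B (ampliate_seq V g n) by move=> S [_]; apply; exists n.
have V1 : star V ** V = @bop_id R H by exact: isometry_starM.
apply/seteqP; split=> [|_ [a [l [Aa ->]]]].
  apply: smallest_sub; first exact/(ampliation_csubalg e01 Vdot Ve0)/cstar_genP.
  move=> _ [[|n] _ <-].
    exists 0, 1; split; first exact: csubalg0 (cstar_genP _).
    by rewrite /ampliate cmul0r cmul0l scale1r add0r.
  exists (g n), 0; split; first by move=> S [_]; apply; exists n.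
  by rewrite /ampliate scale0r addr0.
(* The scalar summand comes from the identity at index 0. For the other one, the operators whose
   conjugate by [V] lies in [B] form a C*-subalgebra containing every [g n], hence containing
   [a]. *)
rewrite /ampliate addrC; apply: (csubalg_lin BP); first exact: (rangeB 0).
pose S := (fun T : bop H => V ** T ** star V) @^-1` B.
suff : S a by [].
apply: Aa; split; last by move=> _ [n _ <-]; exact: (rangeB n.+1).
have Slin := linear_bounded_sandwich V (star V).
split.
- by rewrite /S /= cmul0r cmul0l; exact: (csubalg0 BP).
- by move=> k x y Sx Sy; rewrite /S /= Slin.1; exact: (csubalg_lin BP).
- move=> x y Sx Sy; rewrite /S /=.
  have -> : V ** (x ** y) ** star V = V ** x ** star V ** (V ** y ** star V).
    by rewrite !cmulA -(cmulA (V ** x) (star V)) V1 bop_mulr1.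
  exact: (csubalgM BP Sx Sy).
- move=> x Sx; rewrite /S /=.
  have -> : V ** star x ** star V = star (V ** x ** star V).
    by rewrite !starM starK cmulA.
  exact: (csubalg_star BP Sx).
- apply: closed_comp; last exact: (csubalg_closed BP).
  by move=> T _; apply: ((linear_bounded_continuousP _).1 Slin).2.
Qed.

(** [ampliate] is injective on pairs even when [Cstar g] contains the identity, because
    [scalar_part] reads off [l] at [e0]. *)
Lemma Cstar_ampliate_seq (g : Gamma H) :
  cstar_isomorphic (Cstar (ampliate_seq V g)) (unitization (Cstar g)).
Proof.
have gE := cstar_gen_ampliate_seq g.
set A := CStarSubalg (cstar_genP (range (g : nat -> bop H))).
set B := CStarSubalg (cstar_genP (range (ampliate_seq V g : nat -> bop H))).
have fB (x : unitization (csub A)) :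
    ampliate V (csub_val x.1) x.2 \in csubalg_pred B.
  apply/csubalg_predP; rewrite /= gE; exists (csub_val x.1), x.2; split=> //.
  exact: ((csubalg_predP A _).1 (csub_valP x.1)).
have hA (y : csub B) : compression V e0 (csub_val y) \in csubalg_pred A.
  apply/csubalg_predP; have /csubalg_predP := csub_valP y; rewrite /= gE.
  by move=> [a [l [Aa ->]]]; rewrite compression_ampliate.
apply: cstar_isomorphic_sym; exists (fun x => CSub (fB x)); split.
- by move=> k x y; apply: val_inj; rewrite /= ampliate_linear.
- exists (fun y => (CSub (hA y), scalar_part e0 (csub_val y)) : unitization (csub A)).
    move=> [a l]; congr pair; last by rewrite /= scalar_part_ampliate.
    by apply: val_inj; rewrite /= compression_ampliate.
  move=> y; apply: val_inj => /=.
  have /csubalg_predP := csub_valP y; rewrite /= gE => -[a [l [_ ->]]].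
  by rewrite compression_ampliate// scalar_part_ampliate.
- by move=> x y; apply: val_inj; rewrite /= -ampliateM.
- by move=> x; apply: val_inj; rewrite /= -ampliate_star.
Qed.

End UnitizationOperator.

Theorem lemma3p12 (R : realType) (H : hilbertType R)
    (Hsep : separable_space H) (Hinf : infinite_dimensional H) :
  exists Unit : Gamma H -> Gamma H,
    measurable_fun setT Unit /\
    forall g : Gamma H, cstar_isomorphic (Cstar (Unit g)) (unitization (Cstar g)).
Proof.
have [V [e0 [e01 Vdot Ve0]]] := shift_isometry Hinf.
(* A single [V], chosen before [g], serves all sequences. *)
exists (ampliate_seq V); split; first exact: measurable_ampliate_seq.
by move=> g; exact: (Cstar_ampliate_seq e01 Vdot Ve0).
Qed.
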